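(* Suppose $0<p<2$ and $\mu$ is a positive finite Borel measure on $[0,1)$ which satisfies $\int_{[0,1)}\log\frac{2}{1-t}\,d\mu(t)<\infty$. Then $\mathcal{DH}_{\mu}(H^{\infty})\subseteq\mathcal{Q}_{p}$ if and only if $\mu$ is a $2$-Carleson measure.
   Context: $\mathbb{D}=\{z\in\mathbb{C}:|z|<1\}$ is the open unit disc, $H(\mathbb{D})$ is the space of analytic functions in $\mathbb{D}$, $H^\infty$ is the space of bounded analytic functions in $\mathbb{D}$, and $dA$ is area measure on $\mathbb{D}$. For a finite positive Borel measure $\mu$ on $[0,1)$ let $\mu_n=\int_{[0,1)}t^n\,d\mu(t)$ and $\mu_{n,k}=\mu_{n+k}$ for integers $n,k\ge 0$. For $f(z)=\sum_{k=0}^\infty a_kz^k\in H(\mathbb{D})$, the Derivative-Hilbert operator is $$\mathcal{DH}_\mu(f)(z)=\sum_{n=0}^\infty\Big(\sum_{k=0}^\infty \mu_{n,k}a_k\Big)(n+1)z^n,\quad z\in\mathbb{D},$$ whenever the terms on the right-hand side make sense (each inner series converges) and the resulting function is analytic in $\mathbb{D}$. The inclusion $\mathcal{DH}_\mu(H^\infty)\subseteq\mathcal{Q}_p$ means that for every $f\in H^\infty$, $\mathcal{DH}_\mu(f)$ is well defined in this sense and belongs to $\mathcal{Q}_p$. For $0\le p<\infty$, $\mathcal{Q}_p$ is the set of $f\in H(\mathbb{D})$ with $$\|f\|_{\mathcal{Q}_p}^2=\sup_{w\in\mathbb{D}}\int_{\mathbb{D}}|f'(z)|^2(1-|\sigma_w(z)|^2)^p\,dA(z)<\infty,\qquad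 \sigma_w(z)=\frac{w-z}{1-\bar w z}.$$ For $0<s<\infty$, a positive Borel measure $\mu$ on $[0,1)$ is an $s$-Carleson measure if $\sup_{t\in[0,1)}\frac{\mu([t,1))}{(1-t)^s}<\infty$. *)

(* Defs.v *)
From HB Require Import structures.
From mathcomp Require Import all_boot all_order all_algebra.
From mathcomp Require Import complex.
From mathcomp Require Import all_classical all_reals all_analysis.
Import Order.TTheory GRing.Theory Num.Theory.
Import numFieldNormedType.Exports.

Set Implicit Arguments.
Unset Strict Implicit.
Unset Printing Implicit Defensive.

Local Open Scope classical_set_scope.
Local Open Scope complex_scope.
Local Open Scope ring_scope.

(* [R[i]] gets the topology and the norm that the library puts on [K^o] for
   every [K : numFieldType]; limits and derivatives below are over the scalar
   field [R[i]], so that [derivable] means complex differentiable. *)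
HB.instance Definition _ (R : realType) :=
  PseudoPointedMetric.copy R[i] (R[i])^o.
HB.instance Definition _ (R : realType) :=
  NormedModule.copy R[i] (R[i])^o.

Section DerivativeHilbert.
Variable R : realType.
Local Notation C := R[i].

Definition unit_disc : set C := [set z | `|z| < 1].

Definition analytic_disc (f : C -> C) : Prop :=
  forall z, unit_disc z -> derivable f z 1.

Definition Hinfty (f : C -> C) : Prop :=
  analytic_disc f /\
  exists M : R, forall z, unit_disc z -> `|f z| <= M%:C.

Definition has_expansion (f : C -> C) (a : nat -> C) : Prop :=
  forall z, unit_disc z -> series (fun k => a k * z ^+ k) @ \oo --> f z.

Definition sigma (w z : C) : C := (w - z) / (1 - w^* * z).

Definition area : set (measurableTypeR R * measurableTypeR R) -> \bar R :=
  (@lebesgue_measure R \x @lebesgue_measure R)%E.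

Definition cplx (u : R * R) : C := (u.1 +i* u.2)%C.

(* The library norm on [R[i]] takes its values in [R[i]]. *)
Definition modulus (z : C) : R := complex.Re `|z|.

Definition Qp_integral (p : R) (f : C -> C) (w : C) : \bar R :=
  (\int[area]_(u in cplx @^-1` unit_disc)
     (modulus (derive1 f (cplx u)) ^+ 2 *
      (1 - modulus (sigma w (cplx u)) ^+ 2) `^ p)%:E)%E.

Definition Qp (p : R) (f : C -> C) : Prop :=
  analytic_disc f /\
  (ereal_sup [set Qp_integral p f w | w in unit_disc] < +oo)%E.

(* A Borel measure on [0, 1) is a Borel measure on [R] that is null outside
   [0, 1). *)
Variable mu : {finite_measure set (measurableTypeR R) -> \bar R}.

Definition moment (n : nat) : R := \int[mu]_(t in `[0%R, 1%R[) (t ^+ n).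

Definition DH_inner (a : nat -> C) (n : nat) : nat -> C :=
  series (fun k => (moment (n + k))%:C * a k).

Definition DH_outer (a : nat -> C) (z : C) : nat -> C :=
  series (fun n => limn (DH_inner a n) * n.+1%:R * z ^+ n).

(* The operator acts on [f] through its Taylor coefficients at the origin, the
   unique sequence [a] with [has_expansion f a]. *)
Definition DH (a : nat -> C) (z : C) : C := limn (DH_outer a z).

Definition DH_well_defined (a : nat -> C) : Prop :=
  [/\ forall n, cvgn (DH_inner a n),
      forall z, unit_disc z -> cvgn (DH_outer a z)
    & analytic_disc (DH a)].

Definition DH_Hinfty_sub_Qp (p : R) : Prop :=
  forall (f : C -> C) (a : nat -> C), Hinfty f -> has_expansion f a ->
    DH_well_defined a /\ Qp p (DH a).

Definition Carleson_ratio (s t : R) : \bar R :=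
  (mu `[t, 1%R[%classic * (((1 - t) `^ s)^-1)%:E)%E.

Definition Carleson (s : R) : Prop :=
  (ereal_sup [set Carleson_ratio s t | t in `[0%R, 1%R[] < +oo)%E.

End DerivativeHilbert.

(* Main.v *)
(* With [F = DH f] one has [F'(z) = \int 2 t f(t) / (1 - t z)^3 dmu(t)].

   If [mu] is 2-Carleson, splitting [0, 1) dyadically towards 1 gives
   [|F'(z)| <= const / |1 - z|].  For [X = 1 - |sigma_w(z)|^2],
   [rho = |1 - z|] and [eta = |1 - w|] one has
   [X <= 16 min (rho / eta, eta / rho)], so the integrand defining the Q_p norm
   is at most [const rho^-2 min (rho / eta, eta / rho)^p], whose integral over
   the dyadic squares around 1 of side comparable to [2^k eta] is a two-sided
   geometric series in [2^-p]; the bound does not depend on [w].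

   Conversely, take [f = 1].  On a box of side comparable to [1 - x] next to [x],
   the real part of the kernel [2 t / (1 - t z)^3] is nonnegative, and at least
   [const (1 - x)^-3] for [t >= x]; hence
   [|F'| >= const mu [x, 1) (1 - x)^-3] there, and the Q_p integral at [w = x]
   is at least [const (mu [x, 1) / (1 - x)^2]^2]. *)
Require Import Defs.
From mathcomp Require Import all_boot all_order all_algebra.
From mathcomp Require Import all_solvable all_field zify ring lra.
From mathcomp Require Import complex.
From mathcomp Require Import all_classical all_reals all_analysis measurable_realfun.
Import Order.TTheory GRing.Theory Num.Theory.
Import numFieldNormedType.Exports.
Local Open Scope classical_set_scope.
Local Open Scope ring_scope.

Local Notation Re := complex.Re.
Local Notation Im := complex.Im.

Set Implicit Arguments.
Unset Strict Implicit.
Unset Printing Implicit Defensive.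

(** * Modulus and limits in the complex plane *)

(** The formula for [F'] is never formed as a complex integral. The coefficients of [DH] are limits
    of inner series, so the bounds on [F'] are made on finite sums: a finite combination of moments
    is the integral of a polynomial in [t], taken on real and imaginary parts, and limits come
    afterwards. Two truncations must be removed. That of the kernel is harmless, since
    [|t z| <= |z| < 1] makes its power series converge uniformly in [t]. That of [f] need not be
    uniform up to [t = 1]; it is handled by dilating [f] to [f(r z)], and the return to [r = 1] is
    controlled by the summability of the moments, itself a consequence of the Carleson condition.
    Together with [|a_k| <= sup |f|], the same summability makes the operator well defined. That
    coefficient bound is obtained by averaging over roots of unity. *)

Section ComplexModulus.
Context {R : realType}.
Implicit Types (z w : R[i]) (r : R).

Lemma modulusE z : `|z| = (modulus z)%:C%C.
Proof. by []. Qed.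

Lemma modulus_ge0 z : 0 <= modulus z.
Proof. by have := normr_ge0 z; rewrite modulusE ler0c. Qed.

Lemma modulusM z w : modulus (z * w) = modulus z * modulus w.
Proof. by apply: (@complexI R); rewrite rmorphM /= -!modulusE normrM. Qed.

Lemma modulusD z w : modulus (z + w) <= modulus z + modulus w.
Proof. by rewrite -lecR rmorphD /= -!modulusE ler_normD. Qed.

Lemma modulusN z : modulus (- z) = modulus z.
Proof. by apply: (@complexI R); rewrite -!modulusE normrN. Qed.

Lemma modulus_distC z w : modulus (z - w) = modulus (w - z).
Proof. by rewrite -modulusN opprB. Qed.

Lemma modulusX z n : modulus (z ^+ n) = modulus z ^+ n.
Proof. by apply: (@complexI R); rewrite rmorphXn /= -!modulusE normrX. Qed.

Lemma modulus0 : modulus (0 : R[i]) = 0.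
Proof. by apply: (@complexI R); rewrite -modulusE normr0. Qed.

Lemma modulus1 : modulus (1 : R[i]) = 1.
Proof. by apply: (@complexI R); rewrite -modulusE normr1. Qed.

Lemma modulusV z : modulus z^-1 = (modulus z)^-1.
Proof.
apply: (@complexI R); rewrite -modulusE normfV modulusE.
by rewrite /= -[RHS]/((modulus z)^-1%:C)%C (fmorphV (real_complex R)).
Qed.

Lemma modulus_real r : modulus r%:C%C = `|r|.
Proof. by rewrite /modulus normc_def /= expr0n /= addr0 sqrtr_sqr. Qed.

Lemma modulus_nat n : modulus (n%:R : R[i]) = n%:R.
Proof. by rewrite -(rmorph_nat (real_complex R)) modulus_real ger0_norm. Qed.

Lemma modulus_sqr z : modulus z ^+ 2 = Re z ^+ 2 + Im z ^+ 2.
Proof. by rewrite /modulus normc_def /= sqr_sqrtr // addr_ge0 // sqr_ge0. Qed.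

Lemma modulus_conj z : modulus z^* = modulus z.
Proof. by rewrite /modulus norm_conjC. Qed.

Lemma modulus_gt0 z : (0 < modulus z) = (z != 0).
Proof. by rewrite -ltcR -modulusE normr_gt0. Qed.

Lemma modulusB_ge z w : modulus z - modulus w <= modulus (z - w).
Proof. by rewrite lerBlDr (le_trans _ (modulusD _ _)) // subrK. Qed.

Lemma modulusB_le z w : modulus (z - w) <= modulus z + modulus w.
Proof. by rewrite -(modulusN w) modulusD. Qed.

Lemma modulus_sum I (s : seq I) (P : pred I) (F : I -> R[i]) :
  modulus (\sum_(i <- s | P i) F i) <= \sum_(i <- s | P i) modulus (F i).
Proof.
elim/big_rec2 : _ => [|i y x _ le_xy]; first by rewrite modulus0.
by rewrite (le_trans (modulusD _ _)) // lerD2l.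
Qed.

Lemma normRe_le_modulus z : `|Re z| <= modulus z.
Proof.
rewrite -(@ler_pXn2r _ 2) ?nnegrE ?modulus_ge0 //.
by rewrite modulus_sqr real_normK ?num_real // lerDl sqr_ge0.
Qed.

Lemma normIm_le_modulus z : `|Im z| <= modulus z.
Proof.
rewrite -(@ler_pXn2r _ 2) ?nnegrE ?modulus_ge0 //.
by rewrite modulus_sqr real_normK ?num_real // lerDr sqr_ge0.
Qed.

Lemma modulus_le_ReIm z : modulus z <= `|Re z| + `|Im z|.
Proof.
rewrite -(@ler_pXn2r _ 2) ?nnegrE ?modulus_ge0 ?addr_ge0 //.
rewrite modulus_sqr sqrrD !real_normK ?num_real //.
rewrite (_ : _ + _ *+ 2 + _ = (Re z ^+ 2 + Im z ^+ 2) + `|Re z| * `|Im z| *+ 2); last by ring.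
by rewrite lerDl mulrn_wge0 // mulr_ge0.
Qed.

Lemma in_disc z : unit_disc z = (modulus z < 1) :> Prop.
Proof. by rewrite /unit_disc /= modulusE -ltcR. Qed.

Lemma ReE_sub z w : Re (z - w) = Re z - Re w.
Proof. exact: raddfB. Qed.

Lemma ImE_sub z w : Im (z - w) = Im z - Im w.
Proof. exact: raddfB. Qed.

Lemma Re_sum I (s : seq I) (P : pred I) (F : I -> R[i]) :
  Re (\sum_(i <- s | P i) F i) = \sum_(i <- s | P i) Re (F i).
Proof. exact: raddf_sum. Qed.

Lemma Im_sum I (s : seq I) (P : pred I) (F : I -> R[i]) :
  Im (\sum_(i <- s | P i) F i) = \sum_(i <- s | P i) Im (F i).
Proof. exact: raddf_sum. Qed.

Lemma Re_scale z r : Re (z * r%:C%C) = Re z * r.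
Proof. by case: z => a b /=; rewrite mulr0 subr0. Qed.

Lemma Im_scale z r : Im (z * r%:C%C) = Im z * r.
Proof. by case: z => a b /=; rewrite mulr0 add0r. Qed.

End ComplexModulus.

Section ComplexLimits.
Context {R : realType}.

(** The norm of [R[i]] is [R[i]]-valued, but a positive element of [R[i]] is real, so both notions
    of smallness agree. *)
Lemma cvgC_modulus {T} {F : set_system T} {FF : Filter F} (u : T -> R[i]) (l : R[i]) :
  (u @ F --> l) <-> ((fun x => modulus (l - u x)) @ F --> (0 : R)).
Proof.
split=> [/cvgrPdist_lt h|/cvgrPdist_lt h]; apply/cvgrPdist_lt => e e0.
  have := h e%:C%C; rewrite ltcR => /(_ e0).
  apply: filterS => x; rewrite modulusE ltcR sub0r normrN ger0_norm //.
  exact: modulus_ge0.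
have eE : e = (Re e)%:C%C by rewrite RRe_real // gtr0_real.
move: e0; rewrite eE ltcR => e0; have := h _ e0.
apply: filterS => x; rewrite modulusE ltcR sub0r normrN ger0_norm //.
exact: modulus_ge0.
Qed.

Lemma cvgC_squeeze {T} {F : set_system T} {FF : Filter F} (u : T -> R[i]) (l : R[i])
    (v : T -> R) :
  (\forall x \near F, modulus (l - u x) <= v x) -> v @ F --> (0 : R) -> u @ F --> l.
Proof.
move=> uv v0; apply/cvgC_modulus; apply: (@squeeze_cvgr _ _ _ _ (cst 0) v) => //.
  by apply: filterS uv => x ->; rewrite modulus_ge0.
exact: cvg_cst.
Qed.

Lemma cvgC_ReIm {T} {F : set_system T} {FF : Filter F} (u : T -> R[i]) (l : R[i]) :
  (u @ F --> l) <->
  ((fun x => Re (u x)) @ F --> Re l) /\ ((fun x => Im (u x)) @ F --> Im l).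
Proof.
split=> [/cvgC_modulus h|[hr hi]].
  by split; apply/cvgrPdist_le => e e0; move/cvgrPdist_lt : h => /(_ e e0);
    apply: filterS => x; rewrite sub0r normrN ger0_norm ?modulus_ge0 // => /ltW;
    apply: le_trans; rewrite -?ReE_sub -?ImE_sub ?normRe_le_modulus ?normIm_le_modulus.
apply: (@cvgC_squeeze _ _ _ _ _ (fun x => `|Re l - Re (u x)| + `|Im l - Im (u x)|)).
  by near=> x; rewrite -ReE_sub -ImE_sub modulus_le_ReIm.
rewrite -[0]addr0 -(normr0 R); apply: cvgD; apply: cvg_norm.
  by rewrite -(subrr (Re l)); apply: cvgB => //; exact: cvg_cst.
by rewrite -(subrr (Im l)); apply: cvgB => //; exact: cvg_cst.
Unshelve. all: by end_near. Qed.

Lemma cvgC_lim {T} {F : set_system T} {FF : ProperFilter F} (u : T -> R[i]) (l : R[i]) :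
  u @ F --> l -> lim (u @ F) = l.
Proof. by move=> h; apply: cvg_lim => //; exact: norm_hausdorff. Qed.

Lemma cvg_modulus {T} {F : set_system T} {FF : Filter F} (u : T -> R[i]) (l : R[i]) :
  u @ F --> l -> (fun x => modulus (u x)) @ F --> modulus l.
Proof.
move=> /cvgC_modulus ul; apply/cvgrPdist_le => e e0.
move/cvgrPdist_lt : ul => /(_ e e0); apply: filterS => x.
rewrite sub0r normrN ger0_norm ?modulus_ge0 // => /ltW; apply: le_trans.
rewrite ler_norml modulusB_ge andbT lerNl opprB.
by rewrite modulus_distC modulusB_ge.
Qed.

Lemma modulus_lim_le (u : nat -> R[i]) (l : R[i]) (B : R) :
  u @ \oo --> l -> (forall n, modulus (u n) <= B) -> modulus l <= B.
Proof.
move=> ul uB; have h : (fun n => modulus (u n)) @ \oo --> modulus l by exact: cvg_modulus.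
rewrite -(cvg_lim _ h) //; apply: limr_le; first by apply/cvg_ex; eexists; exact: h.
exact: nearW.
Qed.

Lemma cvgnC_dominated_series (c : nat -> R[i]) (v : nat -> R) :
  (forall n, modulus (c n) <= v n) -> cvgn (series v) -> cvgn (series c).
Proof.
move=> cv cvgv.
have domcvg (f : R[i] -> R) : (forall z, `|f z| <= modulus z) ->
    cvgn (series (fun n => f (c n))).
  move=> fle; apply: normed_cvg; apply: series_le_cvg cvgv => n //=.
    exact: le_trans (modulus_ge0 _) (cv n).
  exact: le_trans (fle _) (cv n).
have /cvg_ex[/= x hx] := domcvg _ normRe_le_modulus.
have /cvg_ex[/= y hy] := domcvg _ normIm_le_modulus.
apply/cvg_ex; exists (x +i* y)%C; apply/cvgC_ReIm; split => /=.
  rewrite (_ : (fun n => _) = series (fun n => Re (c n))) //.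
  by apply/funext => n; rewrite /series /= Re_sum.
rewrite (_ : (fun n => _) = series (fun n => Im (c n))) //.
by apply/funext => n; rewrite /series /= Im_sum.
Qed.

(** The right-hand side depends on [v] only, so one majorant gives a tail bound that is uniform over
    all the series it dominates. *)
Lemma modulus_series_tail_le (c : nat -> R[i]) (v : nat -> R) (l : R[i]) (x : R) :
  (forall n, modulus (c n) <= v n) -> series v @ \oo --> x ->
  series c @ \oo --> l -> forall n, modulus (l - series c n) <= x - series v n.
Proof.
move=> cv vx cl n.
have h1 : (fun m => series v m - series v n) @ \oo --> x - series v n.
  by apply: cvgB vx _; exact: cvg_cst.
have h2 : (fun m => modulus (series c m - series c n)) @ \oo --> modulus (l - series c n).
  by apply: cvg_modulus; apply: (cvgB cl); exact: cvg_cst.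
apply: (ler_cvg_to h2 h1); near=> m.
have nm : (n <= m)%N by near: m; exact: nbhs_infty_ge.
rewrite (sub_series_geq c nm) (sub_series_geq v nm).
apply: (le_trans (modulus_sum _ _ _)).
by apply: ler_sum => i _.
Unshelve. all: by end_near. Qed.

End ComplexLimits.

(** * Power series *)

Section PowerSeries.
Context {R : realType}.
Implicit Types (z h : R[i]) (c : nat -> R[i]).

Lemma natr_geometric_le (q : R) n : 0 <= q -> q < 1 -> n.+1%:R * q ^+ n <= (1 - q)^-1.
Proof.
move=> q0 q1; rewrite -[leRHS]mul1r ler_pdivlMr ?subr_gt0 //.
have -> : n.+1%:R * q ^+ n * (1 - q) = (1 - q) * \sum_(i < n.+1) q ^+ n.
  by rewrite sumr_const card_ord -mulr_natl; ring.
apply: (@le_trans _ _ ((1 - q) * \sum_(i < n.+1) q ^+ i)).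
  apply: ler_wpM2l; first by rewrite subr_ge0 ltW.
  apply: ler_sum => i _.
  by rewrite ler_wiXn2l // ?(ltW q1) // -ltnS.
by rewrite -[1 - q]opprB mulNr -subrX1 opprB gerBl exprn_ge0.
Qed.

(** With [r <= q ^+ 4], one factor [q ^+ n] survives while three others absorb the three factors
    [n + 1]. The power 3 covers coefficients of linear growth times the quadratic factor in the
    remainder of [(z + h) ^+ n]. *)
Lemma cubic_geometric_le (r : R) : 0 <= r -> r < 1 ->
  exists q K : R, [/\ 0 <= q, q < 1, 0 <= K &
    forall n, n.+1%:R ^+ 3 * r ^+ n <= K * q ^+ n].
Proof.
move=> r0 r1; pose q := 1 - (1 - r) / 4.
have q0 : 0 <= q by rewrite /q; lra.
have q1 : q < 1 by rewrite /q; lra.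
(* Bernoulli's inequality [(1 - x) ^+ 4 >= 1 - 4 x], with the difference written as a product. *)
have rq : r <= q ^+ 4.
    rewrite -subr_ge0; set x := (1 - r) / 4.
    have -> : q ^+ 4 - r = x ^+ 2 * ((x - 2) ^+ 2 + 2) by rewrite /q /x; field.
    by rewrite mulr_ge0 ?addr_ge0 ?sqr_ge0.
exists q, ((1 - q)^-1 ^+ 3); split => // [|n].
  by rewrite exprn_ge0 // invr_ge0 subr_ge0 ltW.
apply: (@le_trans _ _ ((n.+1%:R * q ^+ n) ^+ 3 * q ^+ n)).
  have -> : (n.+1%:R * q ^+ n) ^+ 3 * q ^+ n = n.+1%:R ^+ 3 * (q ^+ 4) ^+ n.
    by rewrite exprMn -!exprM -mulrA -exprD mulnC; congr (_ * _ ^+ _); lia.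
  by rewrite ler_wpM2l ?exprn_ge0 // lerXn2r ?nnegrE ?exprn_ge0.
rewrite ler_wpM2r ?exprn_ge0 // lerXn2r ?nnegrE ?mulr_ge0 ?exprn_ge0 //.
  by rewrite invr_ge0 subr_ge0 ltW.
exact: natr_geometric_le.
Qed.

Lemma cvg_series_cubic_geometric (B r : R) : 0 <= r -> r < 1 -> 0 <= B ->
  cvgn (series (fun n => B * n.+1%:R ^+ 3 * r ^+ n)).
Proof.
move=> r0 r1 B0; have [q [K [q0 q1 K0 rq]]] := cubic_geometric_le r0 r1.
apply: (@series_le_cvg _ _ (geometric (B * K) q)) => [n|n|n|] /=.
- by rewrite !mulr_ge0 ?exprn_ge0.
- by rewrite !mulr_ge0 ?exprn_ge0.
- by rewrite -(mulrA B) -(mulrA B); apply: ler_wpM2l.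
- by apply: is_cvg_geometric_series; rewrite ger0_norm.
Qed.

Definition power_sum c z : R[i] := limn (series (fun n => c n * z ^+ n)).

Definition diff_coef c n : R[i] := c n.+1 * n.+1%:R.

Lemma modulus_term_le c (B r : R) z n : 0 <= B -> modulus (c n) <= B * n.+1%:R ^+ 3 ->
  modulus z <= r -> modulus (c n * z ^+ n) <= B * n.+1%:R ^+ 3 * r ^+ n.
Proof.
move=> B0 cB zr; rewrite modulusM modulusX ler_pM ?modulus_ge0 ?exprn_ge0 ?modulus_ge0 //.
by rewrite lerXn2r ?nnegrE ?modulus_ge0 // (le_trans _ zr) ?modulus_ge0.
Qed.

Lemma power_sum_cvg c (B : R) z : (forall n, modulus (c n) <= B * n.+1%:R ^+ 3) ->
  unit_disc z -> series (fun n => c n * z ^+ n) @ \oo --> power_sum c z.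
Proof.
rewrite in_disc => cB z1.
have B0 : 0 <= B by have := le_trans (modulus_ge0 _) (cB 0%N); rewrite expr1n mulr1.
apply: (@cvgnC_dominated_series _ _ (fun n => B * n.+1%:R ^+ 3 * modulus z ^+ n)).
  by move=> n; exact: modulus_term_le.
exact: cvg_series_cubic_geometric (modulus_ge0 _) z1 B0.
Qed.

Lemma diff_coef_le c (B : R) n : (forall n, modulus (c n) <= B * n.+1%:R) ->
  modulus (diff_coef c n) <= 2 * B * n.+1%:R ^+ 3.
Proof.
move=> cB; have B0 : 0 <= B by have := le_trans (modulus_ge0 _) (cB 0%N); rewrite mulr1.
rewrite modulusM modulus_nat; apply: (le_trans (ler_wpM2r _ (cB n.+1))) => //.
have : (1 : R) <= n.+1%:R by rewrite ler1n.
rewrite -[n.+2%:R]natr1; move: (n.+1%:R) => x x1.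
have -> : 2 * B * x ^+ 3 = B * (x + 1) * x + B * (x * (x - 1) * (2 * x + 1)) by ring.
by rewrite lerDl mulr_ge0 // mulr_ge0 ?mulr_ge0; lra.
Qed.

(* Induction on [n]: the remainder satisfies
   [E_(n+1) = (z + h) E_n + n h^2 z^(n-1)]. *)
Lemma power_remainder_le (r : R) z h n : modulus z <= r -> modulus (z + h) <= r ->
  r ^+ 2 * modulus ((z + h) ^+ n - z ^+ n - h * (n%:R * z ^+ n.-1))
    <= n%:R ^+ 2 * modulus h ^+ 2 * r ^+ n.
Proof.
move=> zr zhr; have r0 : 0 <= r := le_trans (modulus_ge0 _) zr.
elim: n => [|n ih].
  by rewrite !expr0 subrr mul0r mulr0 subr0 modulus0 mulr0 expr0n /= !mul0r.
rewrite (_ : _ - _ - _ = (z + h) * ((z + h) ^+ n - z ^+ n - h * (n%:R * z ^+ n.-1))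
    + n%:R * h ^+ 2 * z ^+ n.-1); last first.
  rewrite !exprS /= -natr1; case: n {ih} => [|n] /=; first by rewrite expr0; ring.
  by rewrite -!natr1 !exprS; ring.
apply: (@le_trans _ _ (r * (n%:R ^+ 2 * modulus h ^+ 2 * r ^+ n)
    + n%:R * modulus h ^+ 2 * r ^+ n.+1)).
  apply: (le_trans (ler_wpM2l _ (modulusD _ _))); first by rewrite exprn_ge0.
  rewrite mulrDr; apply: lerD.
    rewrite modulusM mulrCA; apply: ler_pM => //; first exact: modulus_ge0.
    by rewrite mulr_ge0 ?exprn_ge0 ?modulus_ge0.
  rewrite !modulusM !modulusX modulus_nat mulrCA.
  case: n {ih} => [|n] /=; first by rewrite !mul0r.
  rewrite -expr2; apply: ler_wpM2l; first by rewrite mulr_ge0 ?exprn_ge0 ?modulus_ge0.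
  rewrite (exprD _ 2 n : r ^+ n.+2 = _); apply: ler_wpM2l; first exact: exprn_ge0.
  apply: lerXn2r; rewrite ?nnegrE ?modulus_ge0 //.
rewrite [r ^+ n.+1]exprS (_ : _ + _ = (n%:R ^+ 2 + n%:R) * (modulus h ^+ 2 * (r * r ^+ n))); last by ring.
rewrite -[leRHS]mulrA; apply: ler_wpM2r.
  by rewrite !mulr_ge0 ?exprn_ge0 ?modulus_ge0.
rewrite -natr1 sqrrD1 -addrA lerD2l mulr2n -addrA lerDl.
by rewrite addr_ge0.
Qed.

(** For [r] strictly between [|z|] and 1, the remainders of the monomials add up to at most
    [S |h|^2 / r^2] with [S] independent of [h]; dividing by [h] leaves an error of order [|h|]. *)
Lemma power_sum_derive c (B : R) z : (forall n, modulus (c n) <= B * n.+1%:R) ->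
  unit_disc z ->
  h^-1 *: (power_sum c (h + z) - power_sum c z) @[h --> 0^'] -->
    power_sum (diff_coef c) z.
Proof.
move=> cB zD; have z1 : modulus z < 1 by rewrite -in_disc.
have B0 : 0 <= B by have := le_trans (modulus_ge0 _) (cB 0%N); rewrite mulr1.
have nat1 n : (1 : R) <= n.+1%:R by rewrite ler1n.
have cB3 n : modulus (c n) <= B * n.+1%:R ^+ 3.
  by apply: (le_trans (cB n)); rewrite ler_wpM2l // -[leLHS]expr1 ler_weXn2l.
have dB3 n := diff_coef_le n cB.
pose r := (1 + modulus z) / 2.
have zr : modulus z < r by rewrite /r; lra.
have r0 : 0 < r by have := modulus_ge0 z; rewrite /r; lra.
have r1 : r < 1 by rewrite /r; lra.
have /cvg_ex[/= S hS] := cvg_series_cubic_geometric (ltW r0) r1 B0.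
have bound (h : R[i]) : modulus (z + h) <= r ->
    r ^+ 2 * modulus (power_sum c (z + h) - power_sum c z - h * power_sum (diff_coef c) z)
    <= S * modulus h ^+ 2.
  move=> zhr; have zhD : unit_disc (z + h) by rewrite in_disc (le_lt_trans zhr).
  pose E n := (z + h) ^+ n - z ^+ n - h * (n%:R * z ^+ n.-1).
  have cE : series (fun n => c n * E n) @ \oo -->
      power_sum c (z + h) - power_sum c z - h * power_sum (diff_coef c) z.
    (* The constant monomial has no remainder, so [n.+1] terms of [c] match [n] terms of
       [diff_coef c]. *)
    rewrite -(cvg_shiftS); set u := (X in X @ _ --> _).
    have -> : u = fun n => (series (fun n => c n * (z + h) ^+ n) n.+1
        - series (fun n => c n * z ^+ n) n.+1)
        - h * series (fun n => diff_coef c n * z ^+ n) n.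
      apply/funext => n; rewrite /u /series /= -sumrB big_distrr /=.
      rewrite [X in _ - X](_ : _ = \sum_(0 <= k < n.+1) c k * (h * (k%:R * z ^+ k.-1))).
        by rewrite -sumrB; apply: eq_bigr => k _; rewrite /E; ring.
      rewrite big_nat_recl //= mul0r !mulr0 add0r; apply: eq_bigr => k _.
      by rewrite /diff_coef; ring.
    apply: cvgB; first apply: cvgB.
    - by have := power_sum_cvg cB3 zhD; rewrite -cvg_shiftS.
    - by have := power_sum_cvg cB3 zD; rewrite -cvg_shiftS.
    - by apply: cvgM; [exact: cvg_cst|exact: power_sum_cvg dB3 zD].
  have r20 : 0 < r ^+ 2 by rewrite exprn_gt0.
  rewrite -ler_pdivlMl //; apply: (modulus_lim_le cE) => n.
  rewrite ler_pdivlMl // mulrC /series /=.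
  apply: (@le_trans _ _ (modulus h ^+ 2 * series (fun n => B * n.+1%:R ^+ 3 * r ^+ n) n)).
    apply: (@le_trans _ _ (\sum_(0 <= k < n) modulus (c k * E k) * r ^+ 2)).
      by rewrite -mulr_suml ler_wpM2r ?(ltW r20) // modulus_sum.
    rewrite /series /= big_distrr /=; apply: ler_sum => k _.
    rewrite modulusM -mulrA (mulrC _ (r ^+ 2)).
    apply: (le_trans (ler_pM _ _ (cB k) (power_remainder_le _ (ltW zr) zhr))).
    - exact: modulus_ge0.
    - by rewrite mulr_ge0 ?modulus_ge0 ?ltW.
    rewrite [leLHS](_ : _ = modulus h ^+ 2 * (B * (k.+1%:R * k%:R ^+ 2) * r ^+ k)); last by ring.
    apply: ler_wpM2l; first by rewrite sqr_ge0.
    apply: ler_wpM2r; first by rewrite exprn_ge0 ?ltW.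
    rewrite ler_wpM2l // [leRHS]exprS ler_wpM2l // lerXn2r ?nnegrE // ler_nat.
    exact: leqnSn.
  rewrite mulrC ler_wpM2r ?sqr_ge0 //.
  rewrite -(cvg_lim _ hS) //; apply: nondecreasing_cvgn_le.
    apply: nondecreasing_series => k _ _.
    by rewrite !mulr_ge0 ?exprn_ge0 ?(ltW r0).
  by apply/cvg_ex; exists S.
have cvgh : (fun h : R[i] => modulus h) @ 0^' --> (0 : R).
  rewrite -[X in _ --> X]modulus0. apply: cvg_modulus => A /=. exact: nbhs_dnbhs.
apply: (@cvgC_squeeze _ _ _ _ _ _ (fun h : R[i] => S / r ^+ 2 * modulus h)); last first.
  by rewrite -[X in _ --> X](mulr0 (S / r ^+ 2)); apply: cvgM => //; exact: cvg_cst.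
have zh_near : \forall h \near (0 : R[i])^', modulus h < r - modulus z.
  move/cvgrPdist_lt : cvgh => /(_ (r - modulus z)); rewrite subr_gt0 => /(_ zr).
  by apply: filterS => h; rewrite sub0r normrN ger0_norm ?modulus_ge0.
have h_neq0 : \forall h \near (0 : R[i])^', h != 0 by exact: nbhs_dnbhs_neq.
near=> h.
have h0 : h != 0 by near: h.
have hr : modulus (z + h) <= r.
  rewrite (le_trans (modulusD _ _)) // -lerBrDl ltW //; near: h; exact: zh_near.
have mh0 : 0 < modulus h by rewrite modulus_gt0.
have r20 : 0 < r ^+ 2 by rewrite exprn_gt0.
have := bound _ hr; rewrite -ler_pdivlMl // => bh.
rewrite modulus_distC -(ler_pM2r mh0) -modulusM.
rewrite (_ : (_ - _) * h = power_sum c (z + h) - power_sum c z - h * power_sum (diff_coef c) z).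
  by apply: (le_trans bh); rewrite le_eqVlt; apply/orP; left; apply/eqP; field; exact: lt0r_neq0.
rewrite -[_ *: _]/(_ * _) mulrBl (addrC z h) mulrAC mulVf // mul1r; congr (_ - _).
exact: mulrC.
Unshelve. all: by end_near. Qed.

Lemma power_sum_derivable c (B : R) z : (forall n, modulus (c n) <= B * n.+1%:R) ->
  unit_disc z -> derivable (power_sum c) z 1.
Proof.
move=> cB zD; apply/cvg_ex; exists (power_sum (diff_coef c) z).
have := power_sum_derive cB zD.
apply: cvg_trans; apply: near_eq_cvg; near=> h.
by rewrite /= -[h *: 1]/(h * 1) mulr1.
Unshelve. all: by end_near. Qed.

Lemma power_sum_derive1 c (B : R) z : (forall n, modulus (c n) <= B * n.+1%:R) ->
  unit_disc z -> derive1 (power_sum c) z = power_sum (diff_coef c) z.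
Proof. by move=> cB zD; rewrite /derive1; apply: cvgC_lim; exact: power_sum_derive cB zD. Qed.

End PowerSeries.

(** * Cauchy's estimate for the coefficients of a bounded function *)

Section CauchyEstimate.
Context {R : realType}.

(** [X^n - 1] splits and is separable, and [n] distinct [n]-th roots of unity in a field include a
    primitive one. *)
Lemma primitive_root_exists (F : numClosedFieldType) (n : nat) : (0 < n)%N ->
  exists w : F, n.-primitive_root w.
Proof.
move=> n0; have [r Er] := closed_field_poly_normal ('X^n - 1 : {poly F}).
rewrite (monicP (monicXnsubC 1 n0)) scale1r in Er.
have /hasP[w _ ?] : has n.-primitive_root r; last by exists w.
apply: has_prim_root => //.
- by apply/allP => z zr; rewrite /root_of_unity Er root_prod_XsubC.
- rewrite -separable_prod_XsubC -Er separable_Xn_sub_1 //.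
  by rewrite pnatr_eq0 -lt0n.
- by rewrite -ltnS -(size_prod_XsubC r id) -Er size_XnsubC.
Qed.

Lemma sum_prim_root (F : fieldType) (n s : nat) (w : F) : n.-primitive_root w ->
  \sum_(j < n) (w ^+ s) ^+ j = if (n %| s)%N then n%:R else 0.
Proof.
move=> wn; case: ifPn => [ns|ns].
  have -> : w ^+ s = 1 by apply/eqP; rewrite -(prim_order_dvd wn).
  rewrite (eq_bigr (fun=> 1)) => [|j _]; last by rewrite expr1n.
  by rewrite sumr_const card_ord.
have ws : w ^+ s - 1 != 0 by rewrite subr_eq0 -(prim_order_dvd wn).
apply: (mulfI ws); rewrite mulr0 -subrX1 -exprM mulnC exprM (prim_expr_order wn).
by rewrite expr1n subrr.
Qed.

Lemma modulus_prim_root (n : nat) (w : R[i]) : (0 < n)%N -> n.-primitive_root w ->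
  modulus w = 1.
Proof.
move=> n0 wn; have : modulus w ^+ n = 1 by rewrite -modulusX (prim_expr_order wn) modulus1.
by move/eqP; rewrite pexpr_eq1 ?modulus_ge0 // => /eqP.
Qed.

(** Discrete Fourier inversion on a circle. The weight [w ^+ (j * (n - k))] stands for
    [w ^ (- j k)], and truncating at exactly [n] terms excludes aliasing: [0 < n - k + m < 2 n], so
    only [m = k] survives. *)
Lemma coef_root_average (a : nat -> R[i]) (x : R[i]) (n k : nat) (w : R[i]) :
  n.-primitive_root w -> (k < n)%N ->
  \sum_(j < n) w ^+ (j * (n - k)) * series (fun m => a m * (x * w ^+ j) ^+ m) n
    = n%:R * (a k * x ^+ k).
Proof.
move=> wn kn.
transitivity (\sum_(m < n) (a m * x ^+ m) * \sum_(j < n) (w ^+ (n - k + m)) ^+ j).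
  under eq_bigr => j _ do rewrite /series /= big_mkord big_distrr /=.
  rewrite exchange_big /=; apply: eq_bigr => m _; rewrite big_distrr /=.
  apply: eq_bigr => j _; rewrite exprMn -!exprM.
  rewrite [in RHS]mulnC mulnDr exprD; ring.
rewrite (bigD1 (Ordinal kn)) //= subnK ?(ltnW kn) // (sum_prim_root _ wn) dvdnn mulrC.
rewrite -[RHS]addr0; congr (_ + _); apply: big1 => m mk.
rewrite (sum_prim_root _ wn) ifF ?mulr0 //; apply/negP => /dvdnP[[|[|q]] E].
- by lia.
- by move: mk; rewrite -val_eqE /=; lia.
- by have := ltn_ord m; move: E; nia.
Qed.

(** The term [a k * r ^+ k] is an average of values of a partial sum on the circle of radius [r], up
    to unimodular weights; for many terms each such value is within [e] of a value of [f]. *)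
Lemma coef_le_circle (f : R[i] -> R[i]) (a : nat -> R[i]) (M r : R) (k : nat) :
  has_expansion f a -> (forall z, unit_disc z -> modulus (f z) <= M) ->
  0 < r -> r < 1 -> modulus (a k) * r ^+ k <= M.
Proof.
(* Convergence at the larger radius [rho] bounds [|a_m| rho ^+ m], so a geometric series of ratio
   [r / rho] dominates the terms on the whole circle [|z| = r]. *)
move=> fa fM r0 r1; pose rho := (1 + r) / 2.
have rr : r < rho by rewrite /rho; lra.
have rho0 : 0 < rho by exact: lt_trans rr.
have rho1 : rho < 1 by rewrite /rho; lra.
have disc (x : R) : 0 < x -> x < 1 -> unit_disc x%:C%C.
  by move=> x0 x1; rewrite in_disc modulus_real gtr0_norm.
have [B aB] : exists B, forall m, modulus (a m) * rho ^+ m <= B.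
  have := fa _ (disc _ rho0 rho1) => h.
  have h2 : (fun m => modulus (series (fun k => a k * rho%:C%C ^+ k) m.+1
      - series (fun k => a k * rho%:C%C ^+ k) m)) @ \oo --> (0 : R).
    rewrite -[X in _ --> X]modulus0 -(subrr (f rho%:C%C)).
    by apply: cvg_modulus; apply: cvgB => //; rewrite (cvg_shiftS (series _)).
  have /cvg_seq_bounded [B [_ hB]] : cvgn (fun m => modulus (series (fun k => a k * rho%:C%C ^+ k) m.+1
      - series (fun k => a k * rho%:C%C ^+ k) m)) by apply/cvg_ex; exists 0.
  exists (B + 1) => m; have := hB (B + 1); rewrite ltrDl ltr01 => /(_ isT m I) /=.
  rewrite /series /= big_nat_recr //= [X in modulus X]addrC addKr modulusM modulusX modulus_real.
  by rewrite (gtr0_norm rho0) ger0_norm // mulr_ge0 ?modulus_ge0 ?exprn_ge0 ?ltW.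
pose v := geometric B (r / rho).
have rrho : `|r / rho| < 1.
  by rewrite gtr0_norm ?ltr_pdivrMr ?mul1r //; exact: divr_gt0.
have /cvg_ex[/= x hx] : cvgn (series v) by exact: is_cvg_geometric_series.
have tail z m : modulus z = r -> modulus (f z - series (fun k => a k * z ^+ k) m) <= x - series v m.
  move=> zr; apply: (modulus_series_tail_le _ hx) => [j|].
    rewrite modulusM modulusX zr /v /= expr_div_n mulrA mulrAC.
    by rewrite ler_wpM2r ?exprn_ge0 ?(ltW r0) // ler_pdivlMr ?exprn_gt0.
  by apply: fa; rewrite in_disc zr.
apply/ler_addgt0Pr => e e0.
have [n kn ne] : exists2 n, (k < n)%N & x - series v n <= e.
  move/cvgrPdist_le : hx => /(_ e e0) [N _ hN]; exists (maxn k.+1 N).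
    by rewrite leq_maxl.
  by apply: (le_trans (ler_norm _)); apply: hN; exact: leq_maxr.
have n0 : (0 < n)%N by exact: leq_ltn_trans kn.
have [w wn] := primitive_root_exists R[i] n0.
have w1 := modulus_prim_root n0 wn.
have E := coef_root_average a r%:C%C wn kn.
have nR : 0 < n%:R :> R by rewrite ltr0n.
rewrite -(ler_pM2l nR).
have -> : n%:R * (modulus (a k) * r ^+ k) = modulus (n%:R * (a k * r%:C%C ^+ k)).
  by rewrite !modulusM modulus_nat modulusX modulus_real gtr0_norm.
rewrite -E.
apply: (le_trans (modulus_sum _ _ _)).
apply: (@le_trans _ _ (\sum_(j < n) (M + e))); last first.
  by rewrite sumr_const card_ord mulr_natl.
apply: ler_sum => j _; rewrite modulusM modulusX w1 expr1n mul1r.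
set z := r%:C%C * w ^+ j; have zr : modulus z = r.
  by rewrite modulusM modulusX w1 expr1n mulr1 modulus_real gtr0_norm.
rewrite -(subrK (f z) (series _ n)) addrC (le_trans (modulusD _ _)) // lerD //.
  by apply: fM; rewrite in_disc zr.
by rewrite modulus_distC (le_trans (tail _ _ zr)).
Qed.

Lemma cauchy_estimate (f : R[i] -> R[i]) (a : nat -> R[i]) (M : R) (k : nat) :
  has_expansion f a -> (forall z, unit_disc z -> modulus (f z) <= M) ->
  modulus (a k) <= M.
Proof.
move=> fa fM; apply/ler_addgt0Pr => e e0.
set A := modulus (a k); have A0 : 0 <= A := modulus_ge0 _.
(* Chosen so that the Bernoulli loss [A k d] is at most [e]; the bound 1/2 keeps [1 - d] positive
   and the [+ 1] keeps the denominator positive. *)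
pose d := Num.min (1 / 2) (e / (A * k%:R + 1)).
have den : 0 < A * k%:R + 1 by rewrite ltr_wpDl // mulr_ge0.
have d0 : 0 < d by rewrite lt_min divr_gt0 //= divr_gt0.
have d1 : d < 1 by rewrite gt_min; apply/orP; left; lra.
have := @coef_le_circle f a M (1 - d) k fa fM; rewrite subr_gt0 ltrBlDr ltrDl => /(_ d1 d0).
have bern : 1 - k%:R * d <= (1 - d) ^+ k.
  elim: (k) => [|j ih]; first by rewrite mul0r subr0 expr0.
  rewrite exprS -natr1; have : 0 <= 1 - d by rewrite subr_ge0 ltW.
  move/ler_wpM2l => /(_ _ _ ih); apply: le_trans.
  rewrite -subr_ge0 (_ : _ - _ = j%:R * d ^+ 2); last by ring.
  by rewrite mulr_ge0 // sqr_ge0.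
have /(ler_wpM2l A0) := bern; rewrite -/A => h1 h2.
have := le_trans h1 h2; rewrite mulrBr mulr1 lerBlDr => /le_trans; apply.
rewrite lerD2l.
have : d <= e / (A * k%:R + 1) by rewrite ge_min lexx orbT.
rewrite ler_pdivlMr // mulrDr mulr1 => h3; apply: le_trans h3.
by rewrite mulrA mulrC lerDl ltW.
Qed.

End CauchyEstimate.

(** * The kernel [2 / (1 - w) ^+ 3] and its truncations *)

Section KernelSum.
Context {R : realType}.
Implicit Types w : R[i].

(** Truncated power series of [2 / (1 - w) ^+ 3]: [j.+2] is the weight of the operator at degree
    [j.+1], and [j.+1] comes from differentiation. *)
Definition kernel_sum n w : R[i] := \sum_(j < n) (j.+1 * j.+2)%:R * w ^+ j.

Lemma kernel_sum_cube n w : (1 - w) ^+ 3 * kernel_sum n w =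
  2 - w ^+ n * ((n.+1 * n.+2)%:R - (2 * n * n.+2)%:R * w + (n * n.+1)%:R * w ^+ 2).
Proof.
rewrite /kernel_sum; elim: n => [|n ih].
  by rewrite big_ord0 expr0 !mulr0 muln0 !mul0n; ring.
rewrite big_ord_recr /= mulrDr ih [w ^+ n.+1]exprS !natrM -!natr1; ring.
Qed.

(** Uniformity on a disc of radius [s < 1] is the point: for fixed [z] it covers [w = t z] for all
    [t] in [[0, 1)] at once. The remainder is [w ^+ n] times a quadratic whose coefficients grow
    polynomially in [n]. *)
Lemma kernel_sum_close (s : R) : 0 <= s -> s < 1 ->
  exists2 e : nat -> R, e @ \oo --> (0 : R) &
  forall n w, modulus w <= s -> modulus (kernel_sum n w - 2 / (1 - w) ^+ 3) <= e n.
Proof.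
move=> s0 s1; have [q [K [q0 q1 K0 sq]]] := cubic_geometric_le s0 s1.
have ms0 : 0 < 1 - s by rewrite subr_gt0.
exists (fun n => 8 * (1 - s)^-1 ^+ 3 * K * q ^+ n) => [|n w ws].
  rewrite -[X in _ --> X](mulr0 (8 * (1 - s)^-1 ^+ 3 * K)).
  by apply: cvgM; [exact: cvg_cst|apply: cvg_expr; rewrite ger0_norm].
have sw : 1 - s <= modulus (1 - w).
  by rewrite (le_trans _ (modulusB_ge _ _)) // modulus1 lerB.
have w1 : (1 - w) ^+ 3 != 0.
  by rewrite expf_neq0 // -modulus_gt0 (lt_le_trans ms0).
rewrite (_ : _ - _ = - (w ^+ n * ((n.+1 * n.+2)%:R - (2 * n * n.+2)%:R * w + (n * n.+1)%:R * w ^+ 2))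
   / (1 - w) ^+ 3); last first.
  by apply: (mulfI w1); rewrite mulrBr kernel_sum_cube [RHS]mulrC [X in _ - X]mulrC !divfK //; ring.
rewrite modulusM modulusN modulusM modulusV !modulusX.
have W : modulus ((n.+1 * n.+2)%:R - (2 * n * n.+2)%:R * w + (n * n.+1)%:R * w ^+ 2)
    <= 8 * n.+1%:R ^+ 3.
  have w1' : modulus w <= 1 by rewrite (le_trans ws) // ltW.
  apply: (@le_trans _ _ ((n.+1 * n.+2)%:R + (2 * n * n.+2)%:R + (n * n.+1)%:R)).
    rewrite (le_trans (modulusD _ _)) // lerD //.
      rewrite (le_trans (modulusB_le _ _)) // modulusM !modulus_nat lerD2l.
      by rewrite ler_piMr.
    by rewrite modulusM modulus_nat modulusX ler_piMr // exprn_ile1 // modulus_ge0.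
  rewrite -!natrD -natrX -natrM ler_nat !expnS; nia.
have -> : 8 * (1 - s)^-1 ^+ 3 * K * q ^+ n = (8 * (K * q ^+ n)) * (1 - s)^-1 ^+ 3 by ring.
apply: ler_pM.
- by rewrite mulr_ge0 ?exprn_ge0 ?modulus_ge0.
- by rewrite invr_ge0 exprn_ge0 ?modulus_ge0.
- apply: (@le_trans _ _ (s ^+ n * (8 * n.+1%:R ^+ 3))).
    by rewrite ler_pM ?exprn_ge0 ?modulus_ge0 // lerXn2r ?nnegrE ?modulus_ge0.
  by rewrite mulrCA (mulrC (s ^+ n)) ler_wpM2l.
- rewrite -exprVn lerXn2r ?nnegrE ?invr_ge0 ?modulus_ge0 ?(ltW ms0) //.
  by rewrite lef_pV2 ?posrE // (lt_le_trans ms0).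
Qed.

End KernelSum.

(** * Moments of the measure *)

Section Moments.
Context {R : realType}.
Variable mu : {finite_measure set (measurableTypeR R) -> \bar R}.

Local Notation I01 := (`[0%R, 1%R[%classic : set (measurableTypeR R)).

Lemma I01E (t : R) : I01 t = (0 <= t < 1) :> Prop.
Proof. by rewrite /= in_itv. Qed.

Lemma mu_lty (A : set (measurableTypeR R)) : measurable A -> (mu A < +oo)%E.
Proof. by move=> mA; rewrite ltey_eq fin_num_measure. Qed.

Lemma integrable_I01 (g : R -> R) (B : R) : measurable_fun I01 g ->
  (forall t, 0 <= t < 1 -> `|g t| <= B) -> mu.-integrable I01 (EFin \o g).
Proof.
move=> mg gB; apply: measurable_bounded_integrable => //; first exact: mu_lty.
by exists B; split; rewrite ?num_real // => x Bx t /=; rewrite in_itv /= => t01;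
  rewrite (le_trans (gB _ t01)) // ltW.
Qed.

Lemma integrable_monomial (c : R) n : mu.-integrable I01 (EFin \o (fun t => c * t ^+ n)).
Proof.
apply: (@integrable_I01 _ `|c|); first by apply: measurable_funM => //; exact: measurable_funX.
move=> t /andP[t0 t1]; rewrite normrM ler_piMr // normrX ger0_norm //.
by rewrite exprn_ile1 // ltW.
Qed.

Lemma integrable_add (f g : R -> R) : mu.-integrable I01 (EFin \o f) ->
  mu.-integrable I01 (EFin \o g) -> mu.-integrable I01 (EFin \o (fun t => f t + g t)).
Proof.
move=> fi gi; rewrite (_ : _ \o _ = (EFin \o f) \+ (EFin \o g))%E //.
exact: integrableD.
Qed.

(** The bridge from moments to kernels. Integrability is carried through the induction because
    linearity of the integral asks for it; the free exponents [e] allow double sums as well. *)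
Lemma moment_sum I (s : seq I) (d : I -> R) (e : I -> nat) :
  mu.-integrable I01 (EFin \o (fun t => \sum_(i <- s) d i * t ^+ e i)) /\
  \sum_(i <- s) d i * moment mu (e i)
    = \int[mu]_(t in I01) \sum_(i <- s) d i * t ^+ e i.
Proof.
elim: s => [|i s [ih1 ih2]].
  split; last by under eq_Rintegral => x _ do rewrite big_nil; rewrite big_nil Rintegral_cst // mul0r.
  rewrite [X in EFin \o X](_ : _ = cst 0); last by apply/funext => t; rewrite big_nil.
  by apply: (@integrable_I01 _ 0) => // t _; rewrite normr0.
have mono := integrable_monomial (d i) (e i).
split.
  rewrite [X in EFin \o X](_ : _ = (fun t => d i * t ^+ e i + \sum_(j <- s) d j * t ^+ e j));
    last by apply/funext => t; rewrite big_cons.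
  exact: integrable_add.
under eq_Rintegral => x _ do rewrite big_cons.
rewrite RintegralD // big_cons ih2 RintegralZl //.
apply: (@integrable_I01 _ 1); first exact: measurable_funX.
by move=> t /andP[t0 t1]; rewrite normrX ger0_norm // exprn_ile1 // ltW.
Qed.

Lemma moment_ge0 n : 0 <= moment mu n.
Proof. by apply: Rintegral_ge0 => t; rewrite I01E => /andP[t0 _]; rewrite exprn_ge0. Qed.

Lemma moment_nonincreasing m n : (m <= n)%N -> moment mu n <= moment mu m.
Proof.
have int k : mu.-integrable I01 (EFin \o (fun t : R => t ^+ k)).
  have := integrable_monomial 1 k; rewrite [X in EFin \o X](_ : _ = (fun t => t ^+ k)) //.
  by apply/funext => t; rewrite mul1r.
move=> mn; apply: le_Rintegral => //; [exact: int|exact: int|move=> t]; rewrite I01E => /andP[t0 t1].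
by rewrite ler_wiXn2l // ltW.
Qed.

End Moments.

(** * Integrals of dyadic layers under a tail bound *)

Section CarlesonBounds.
Context {R : realType}.
Variable mu : {finite_measure set (measurableTypeR R) -> \bar R}.
Variable C : R.
Hypothesis mu_tail : forall s : R, 0 < s -> fine (mu `[1 - s, 1%R[%classic) <= C * s ^+ 2.

Local Notation I01 := (`[0%R, 1%R[%classic : set (measurableTypeR R)).

(** The layers are nested rather than disjoint, so the integral is read off from tail masses alone;
    stopping at [K] keeps the function bounded. *)
Definition dyadic_majorant (al K : nat) (t : R) : R :=
  1 + \sum_(j < K) 2 ^+ (al * j.+1) * \1_(`[1 - 2^-1 ^+ j, 1[%classic : set R) t.

Lemma dyadic_majorant_ge0 (al K : nat) (t : R) : 0 <= dyadic_majorant al K t.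
Proof.
by rewrite addr_ge0 //; apply: sumr_ge0 => j _; rewrite mulr_ge0 ?exprn_ge0.
Qed.

(* [1 + sum_j 2^(al (j+1)) 1_[1 - 2^-j, 1)] dominates
   [min (1 / (1 - t), 2^K)^al]. *)
Lemma dyadic_majorant_ge (al K : nat) (t v : R) : 0 <= t < 1 ->
  0 <= v -> v <= (1 - t)^-1 -> v <= 2 ^+ K -> v ^+ al <= dyadic_majorant al K t.
Proof.
move=> /andP[t0 t1] v0 vt; have t1' : 0 < 1 - t by rewrite subr_gt0.
elim: K => [|K ih] vK.
  by rewrite /dyadic_majorant big_ord0 addr0 exprn_ile1.
rewrite /dyadic_majorant big_ord_recr /= addrA -/(dyadic_majorant al K t).
have [vK'|vK'] := leP v (2 ^+ K).
  by rewrite (le_trans (ih vK')) // lerDl mulr_ge0 ?exprn_ge0 // indicE.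
rewrite indicE mem_set ?mulr1 /=.
  rewrite (_ : 2 ^+ _ = (2 ^+ K.+1) ^+ al); last by rewrite -exprM mulnC.
  rewrite -[leLHS]add0r lerD ?dyadic_majorant_ge0 //.
  by rewrite lerXn2r ?nnegrE ?exprn_ge0.
rewrite in_itv /= t1 andbT lerBlDr -lerBlDl exprVn -[leLHS]invrK.
rewrite lef_pV2 ?posrE ?invr_gt0 ?exprn_gt0 //.
exact: le_trans (ltW vK') vt.
Qed.

Lemma integrable_indicator (c : R) (A : set (measurableTypeR R)) : measurable A ->
  mu.-integrable I01 (EFin \o (fun t => c * \1_A t)).
Proof.
move=> mA; apply: (@integrable_I01 _ _ _ `|c|); first by apply: measurable_funM.
move=> t _; rewrite normrM ler_piMr // indicE.
by case: (_ \in _); rewrite ?normr0 ?normr1.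
Qed.

Lemma Rintegral_indicator (c : R) (A : set (measurableTypeR R)) : measurable A ->
  \int[mu]_(t in I01) (c * \1_A t) = c * fine (mu (A `&` I01)).
Proof.
move=> mA; rewrite RintegralZl //; last first.
  have := integrable_indicator 1 mA; rewrite [X in EFin \o X](_ : _ = \1_A) //.
  by apply/funext => t; rewrite mul1r.
by rewrite /Rintegral integral_indic.
Qed.

Lemma dyadic_majorant_integrable (al K : nat) :
  mu.-integrable I01 (EFin \o dyadic_majorant al K).
Proof.
rewrite /dyadic_majorant; elim: K => [|K ih].
  rewrite [X in EFin \o X](_ : _ = cst 1); last by apply/funext => t; rewrite big_ord0 addr0.
  by apply: (@integrable_I01 _ _ _ 1) => // t _; rewrite normr1.
rewrite [X in EFin \o X](_ : _ = (fun t => dyadic_majorant al K t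
    + 2 ^+ (al * K.+1) * \1_(`[1 - 2^-1 ^+ K, 1[%classic : set R) t));
  last by apply/funext => t; rewrite big_ord_recr /= addrA.
by apply: integrable_add => //; exact: integrable_indicator.
Qed.

Lemma dyadic_majorant_integral (al K : nat) :
  \int[mu]_(t in I01) dyadic_majorant al K t
    <= C + \sum_(j < K) C * 2 ^+ (al * j.+1) * 4^-1 ^+ j.
Proof.
rewrite /dyadic_majorant; elim: K => [|K ih].
  under eq_Rintegral => x _ do rewrite big_ord0 addr0.
  rewrite big_ord0 addr0 Rintegral_cst // mul1r.
  by have := mu_tail ltr01; rewrite subrr expr1n mulr1.
under eq_Rintegral => x _ do rewrite big_ord_recr /= addrA.
rewrite RintegralD //; [|exact: dyadic_majorant_integrable|exact: integrable_indicator].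
rewrite big_ord_recr /= addrA lerD // Rintegral_indicator //.
rewrite (mulrC C) -mulrA ler_wpM2l ?exprn_ge0 //.
rewrite setIidl; last first.
  apply: subset_itvr; rewrite bnd_simp subr_ge0 exprn_ile1 ?invr_ge0 //.
  by rewrite invf_le1 // ler1n.
have s0 : 0 < 2^-1 ^+ K :> R by rewrite exprn_gt0 // invr_gt0.
apply: (le_trans (mu_tail s0)).
by rewrite exprAC (_ : 2^-1 ^+ 2 = 4^-1 :> R) //; field.
Qed.

Lemma tail_const_ge0 : 0 <= C.
Proof.
have := mu_tail ltr01; rewrite expr1n mulr1; apply: le_trans.
by rewrite fine_ge0.
Qed.

(** The weights double while the masses shrink by 4: the ratio 1/2 gives a bound free of [K], a
    truncated form of the finiteness of the integral of [1 / (1 - t)]. *)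
Lemma dyadic_majorant1_le K : \int[mu]_(t in I01) dyadic_majorant 1 K t <= 5 * C.
Proof.
apply: (le_trans (dyadic_majorant_integral _ _)).
suff -> : \sum_(j < K) C * 2 ^+ (1 * j.+1) * 4^-1 ^+ j = 4 * C * (1 - 2^-1 ^+ K).
  rewrite (_ : 5 * C = C + 4 * C); last by ring.
  rewrite lerD2l ler_piMr ?mulr_ge0 ?tail_const_ge0 // gerBl exprn_ge0 //.
elim: K => [|K ih]; first by rewrite big_ord0 expr0 subrr mulr0.
have E : 2 ^+ (1 * K.+1) * 4^-1 ^+ K = 2 * 2^-1 ^+ K :> R.
  by rewrite mul1n exprS -mulrA -exprMn; congr (_ * _ ^+ _); field.
by rewrite big_ord_recr /= ih -[_ * _ * 4^-1 ^+ K]mulrA [X in _ + C * X]E exprS; field.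
Qed.

(** Here the ratio is 8/4 = 2, so the last layer dominates; with [2 ^+ K] comparable to
    [1 / |1 - z|] this is the growth rate of the derivative. *)
Lemma dyadic_majorant3_le K : \int[mu]_(t in I01) dyadic_majorant 3 K t <= 9 * C * 2 ^+ K.
Proof.
apply: (le_trans (dyadic_majorant_integral _ _)).
suff -> : \sum_(j < K) C * 2 ^+ (3 * j.+1) * 4^-1 ^+ j = 8 * C * (2 ^+ K - 1).
  have K1 : 1 <= 2 ^+ K :> R by rewrite exprn_ege1 // ler1n.
  rewrite -subr_ge0 (_ : _ - _ = C * (2 ^+ K - 1) + 8 * C); last by ring.
  by rewrite addr_ge0 ?mulr_ge0 ?subr_ge0 ?tail_const_ge0.
elim: K => [|K ih]; first by rewrite big_ord0 expr0 subrr mulr0.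
have E : 2 ^+ (3 * K.+1) * 4^-1 ^+ K = 8 * 2 ^+ K :> R.
  by rewrite exprM exprS -mulrA -exprMn; congr (_ * _ ^+ _); field.
by rewrite big_ord_recr /= ih -[_ * _ * 4^-1 ^+ K]mulrA [X in _ + C * X]E exprS; ring.
Qed.

(** The geometric sum of the [t ^+ i] is at most both [1 / (1 - t)] and [n <= 2 ^+ n], hence below
    the majorant with [K = n]. *)
Lemma moment_series_le n : series (moment mu) n <= 5 * C.
Proof.
rewrite /series /= big_mkord.
have [int E] := moment_sum mu (index_enum 'I_n) (fun=> 1) (fun i => nat_of_ord i).
rewrite (eq_bigr (fun i : 'I_n => 1 * moment mu i)) => [|i _]; last by rewrite mul1r.
rewrite E; apply: (le_trans _ (dyadic_majorant1_le n)).
apply: le_Rintegral => //; first exact: dyadic_majorant_integrable.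
move=> t; rewrite I01E => /andP[t0 t1]; have t1' : 0 < 1 - t by rewrite subr_gt0.
rewrite -[leLHS]expr1; apply: dyadic_majorant_ge; first by rewrite t0.
- by apply: sumr_ge0 => i _; rewrite mul1r exprn_ge0.
- rewrite -[leRHS]mul1r ler_pdivlMr // mulrC.
  under eq_bigr do rewrite mul1r.
  by rewrite -opprB mulNr -subrX1 opprB gerBl exprn_ge0.
- apply: (@le_trans _ _ n%:R); last by rewrite -natrX ler_nat ltnW // ltn_expl.
  rewrite -[n in n%:R]card_ord -sumr_const; apply: ler_sum => i _.
  by rewrite mul1r exprn_ile1 // ltW.
Qed.

Lemma moment_summable : cvgn (series (moment mu)).
Proof.
apply: nondecreasing_is_cvgn.
  by apply: nondecreasing_series => n _ _; exact: moment_ge0.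
by exists (5 * C) => _ [n _ <-]; exact: moment_series_le.
Qed.

End CarlesonBounds.

(** * Combinations of inner series, by truncation and dilation *)

Section InnerSums.
Context {R : realType}.
Variable mu : {finite_measure set (measurableTypeR R) -> \bar R}.
Hypothesis mu_summable : cvgn (series (moment mu)).

Local Notation I01 := (`[0%R, 1%R[%classic : set (measurableTypeR R)).

(** Real and imaginary parts are bounded separately by real integrals, which costs the factor 2. *)
Lemma moment_sum_modulus_le I (s : seq I) (d : I -> R[i]) (e : I -> nat) (h : R -> R) :
  mu.-integrable I01 (EFin \o h) ->
  (forall t, 0 <= t < 1 -> modulus (\sum_(i <- s) d i * (t ^+ e i)%:C%C) <= h t) ->
  modulus (\sum_(i <- s) d i * (moment mu (e i))%:C%C) <= 2 * \int[mu]_(t in I01) h t.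
Proof.
move=> hi dh; rewrite (le_trans (modulus_le_ReIm _)) //.
have real_bound (g : I -> R) :
    (forall t, 0 <= t < 1 -> `|\sum_(i <- s) g i * t ^+ e i| <= h t) ->
    `|\sum_(i <- s) g i * moment mu (e i)| <= \int[mu]_(t in I01) h t.
  move=> gh; have [gi ->] := moment_sum mu s g e.
  apply: (le_trans (le_normr_Rintegral _ gi)) => //.
  apply: le_Rintegral; [by []|exact: (integrable_norm gi)|by []|].
  by move=> t; rewrite I01E; exact: gh.
rewrite mulr_natl mulr2n lerD //.
  rewrite Re_sum (eq_bigr _ (fun i _ => Re_scale _ _)); apply: real_bound => t t01.
  rewrite -(eq_bigr _ (fun i _ => Re_scale _ _)) -Re_sum.
  exact: le_trans (normRe_le_modulus _) (dh _ t01).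
rewrite Im_sum (eq_bigr _ (fun i _ => Im_scale _ _)); apply: real_bound => t t01.
rewrite -(eq_bigr _ (fun i _ => Im_scale _ _)) -Im_sum.
exact: le_trans (normIm_le_modulus _) (dh _ t01).
Qed.

Lemma DH_inner_cvg (a : nat -> R[i]) (M : R) n : (forall k, modulus (a k) <= M) ->
  cvgn (DH_inner mu a n).
Proof.
move=> aM; apply: (@cvgnC_dominated_series _ _ (fun k => M * moment mu k)) => [k|].
  rewrite modulusM modulus_real ger0_norm ?moment_ge0 // mulrC.
  by rewrite ler_pM ?modulus_ge0 ?moment_ge0 // moment_nonincreasing // leq_addl.
exact: (is_cvg_seriesZ mu_summable).
Qed.

(** Once the inner series are cut at [K], the moments [mu_(n+1+k)] turn the double sum into the
    integral of a product, a partial sum of [f] times the polynomial of [p]. The slack [tau] lets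
    partial sums exceed [M] by an amount that vanishes with [K]. *)
Lemma DH_sum_le_uniform (a p : nat -> R[i]) (h : R -> R) (M : R) (tau : nat -> R) (N : nat) :
  (forall n, cvgn (DH_inner mu a n)) ->
  tau @ \oo --> (0 : R) ->
  (forall K t, 0 <= t < 1 -> modulus (\sum_(k < K) a k * (t ^+ k)%:C%C) <= M + tau K) ->
  mu.-integrable I01 (EFin \o h) ->
  (forall t, 0 <= t < 1 -> modulus (\sum_(n < N) p n * (t ^+ n.+1)%:C%C) <= h t) ->
  modulus (\sum_(n < N) p n * limn (DH_inner mu a n.+1))
    <= 2 * (M * \int[mu]_(t in I01) h t).
Proof.
move=> acvg tau0 aM hi ph; set I := \int[mu]_(t in I01) h t.
have lim1 : (fun K => modulus (\sum_(n < N) p n * DH_inner mu a n.+1 K)) @ \oo -->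
    modulus (\sum_(n < N) p n * limn (DH_inner mu a n.+1)).
  apply: cvg_modulus; apply: cvg_big => [|n _]; first exact: add_continuous.
  by apply: cvgM; [exact: cvg_cst|exact: acvg].
have lim2 : (fun K => 2 * ((M + tau K) * I)) @ \oo --> 2 * (M * I).
  apply: cvgM; first exact: cvg_cst.
  apply: cvgM; last exact: cvg_cst.
  by rewrite -[X in _ --> X]addr0; apply: cvgD => //; exact: cvg_cst.
apply: (ler_cvg_to lim1 lim2); apply: nearW => K.
pose ix := index_enum ('I_N * 'I_K)%type.
have -> : \sum_(n < N) p n * DH_inner mu a n.+1 K =
    \sum_(i <- ix) (p i.1 * a i.2) * (moment mu (i.1.+1 + i.2))%:C%C.
  rewrite -(pair_bigA _ (fun n k => p (nat_of_ord n) * a (nat_of_ord k) * (moment mu (n.+1 + k))%:C%C)) /=.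
  apply: eq_bigr => n _; rewrite /DH_inner /series /= big_mkord big_distrr /=.
  by apply: eq_bigr => k _; ring.
rewrite (_ : (M + tau K) * I = \int[mu]_(t in I01) ((M + tau K) * h t)); last by rewrite RintegralZl.
apply: moment_sum_modulus_le => [|t t01].
  rewrite (_ : _ \o _ = (fun t => (M + tau K)%:E * (EFin \o h) t))%E //.
  exact: integrableZl.
have -> : \sum_(i <- ix) p i.1 * a i.2 * (t ^+ (i.1.+1 + i.2))%:C%C =
    (\sum_(k < K) a k * (t ^+ k)%:C%C) * (\sum_(n < N) p n * (t ^+ n.+1)%:C%C).
  rewrite -(pair_bigA _ (fun n k => p (nat_of_ord n) * a (nat_of_ord k) * (t ^+ (n.+1 + k))%:C%C)) /=.
  rewrite mulrC big_distrlr /=; apply: eq_bigr => n _; apply: eq_bigr => k _.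
  by rewrite exprD rmorphM /=; ring.
by rewrite modulusM ler_pM ?modulus_ge0 ?aM ?ph.
Qed.

Lemma moment_tail_le (m K : nat) :
  \sum_(0 <= k < K) (if (m <= k)%N then moment mu k else 0)
    <= limn (series (moment mu)) - series (moment mu) m.
Proof.
rewrite lerBrDl.
have -> : series (moment mu) m + \sum_(0 <= k < K) (if (m <= k)%N then moment mu k else 0)
    = series (moment mu) (maxn m K).
  elim: K => [|K ih]; first by rewrite big_nil addr0 maxn0.
  rewrite big_nat_recr //= addrA ih; case: leqP => mK.
    by rewrite (maxn_idPr (leqW mK)) [RHS]/series /= big_nat_recr.
  by rewrite addr0 (maxn_idPl mK).
apply: nondecreasing_cvgn_le => //.
by apply: nondecreasing_series => n _ _; exact: moment_ge0.
Qed.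

Lemma onem_expr_le (r : R) k : 0 <= r -> r <= 1 -> 1 - r ^+ k <= k%:R * (1 - r).
Proof.
move=> r0 r1; rewrite -opprB subrX1 -mulNr opprB mulrC ler_wpM2r ?subr_ge0 //.
rewrite -[k in k%:R]card_ord -sumr_const; apply: ler_sum => i _.
by rewrite exprn_ile1.
Qed.

(* The partial sums of [f] need not be bounded by [M], so [DH_sum_le] first
   replaces [f] by [f(r z)], whose partial sums converge uniformly on [0, 1). *)
Lemma DH_inner_dilation_close (a : nat -> R[i]) (M r : R) n m :
  (forall k, modulus (a k) <= M) -> 0 <= r -> r <= 1 ->
  modulus (limn (DH_inner mu a n) - limn (DH_inner mu (fun k => a k * (r ^+ k)%:C%C) n))
  <= M * (limn (series (moment mu)) * (m%:R * (1 - r))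
      + (limn (series (moment mu)) - series (moment mu) m)).
Proof.
move=> aM r0 r1; have M0 : 0 <= M := le_trans (modulus_ge0 _) (aM 0%N).
have rk k : 0 <= r ^+ k <= 1 by rewrite exprn_ge0 // exprn_ile1.
have arM k : modulus (a k * (r ^+ k)%:C%C) <= M.
  have /andP[h1 h2] := rk k; rewrite modulusM modulus_real ger0_norm //.
  by rewrite -[leRHS]mulr1 ler_pM ?modulus_ge0.
have h : (fun K => DH_inner mu a n K - DH_inner mu (fun k => a k * (r ^+ k)%:C%C) n K) @ \oo -->
   limn (DH_inner mu a n) - limn (DH_inner mu (fun k => a k * (r ^+ k)%:C%C) n).
  by apply: cvgB; exact: DH_inner_cvg.
apply: (modulus_lim_le h) => K; rewrite /DH_inner /series /= -sumrB.
apply: (le_trans (modulus_sum _ _ _)).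
(* Split at [m]: below it [1 - r ^+ k <= m (1 - r)], from it on [1 - r ^+ k <= 1] and only the tail
   of the moments counts. *)
apply: (@le_trans _ _ (\sum_(0 <= k < K) M * (moment mu k * (m%:R * (1 - r))
     + (if (m <= k)%N then moment mu k else 0)))).
  apply: ler_sum => k _; have /andP[h1 h2] := rk k.
  rewrite (_ : _ - _ = a k * (moment mu (n + k) * (1 - r ^+ k))%:C%C); last first.
    by rewrite rmorphM rmorphB rmorph1 /=; ring.
  have mom : 0 <= moment mu (n + k) <= moment mu k.
    by rewrite moment_ge0 moment_nonincreasing // leq_addl.
  have /andP[mom1 mom2] := mom.
  rewrite modulusM modulus_real ger0_norm; last by rewrite mulr_ge0 ?subr_ge0.
  apply: ler_pM => //; [exact: modulus_ge0|by rewrite mulr_ge0 ?subr_ge0|].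
  case: leqP => mk.
    rewrite -[leLHS]add0r lerD //.
      by rewrite !mulr_ge0 ?moment_ge0 ?subr_ge0.
    by rewrite -[leRHS]mulr1 ler_pM ?subr_ge0 // gerBl.
  rewrite addr0; apply: ler_pM => //; first by rewrite subr_ge0.
  apply: (le_trans (onem_expr_le _ r0 r1)); rewrite ler_wpM2r ?subr_ge0 // ler_nat.
  exact: ltnW.
rewrite -big_distrr /= ler_wpM2l // big_split /= lerD ?moment_tail_le //.
rewrite -mulr_suml ler_wpM2r ?mulr_ge0 ?subr_ge0 //.
apply: (nondecreasing_cvgn_le (u_ := series (moment mu))) => //.
by apply: nondecreasing_series => k _ _; exact: moment_ge0.
Qed.

(** The split point is taken equal to [L]: the radii tend to 1 fast enough that [L (1 - r L)]
    vanishes, and so does the moment tail beyond [L]. *)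
Lemma DH_inner_dilation_cvg (a : nat -> R[i]) (M : R) (r : nat -> R) n :
  (forall k, modulus (a k) <= M) -> (forall L, 0 <= r L <= 1) ->
  (forall L, L%:R * (1 - r L) <= L.+1%:R^-1) ->
  (fun L => limn (DH_inner mu (fun k => a k * (r L ^+ k)%:C%C) n)) @ \oo -->
    limn (DH_inner mu a n).
Proof.
move=> aM r01 rL; have M0 : 0 <= M := le_trans (modulus_ge0 _) (aM 0%N).
set S := limn (series (moment mu)).
have S0 : 0 <= S by apply: limr_ge => //; apply: nearW => K; apply: sumr_ge0 => i _; exact: moment_ge0.
apply: (@cvgC_squeeze _ _ _ _ _ _
   (fun L => M * (S * L.+1%:R^-1 + (S - series (moment mu) L)))).
  apply: nearW => L; have /andP[r0 r1] := r01 L.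
  apply: (le_trans (DH_inner_dilation_close n L aM r0 r1)).
  by rewrite ler_wpM2l // lerD2r ler_wpM2l.
rewrite -[X in _ --> X](mulr0 M); apply: cvgM; first exact: cvg_cst.
rewrite -[X in _ --> X]addr0; apply: cvgD.
  by rewrite -[X in _ --> X](mulr0 S); apply: cvgM; [exact: cvg_cst|exact: cvg_harmonic].
by rewrite -(subrr S); apply: cvgB; [exact: cvg_cst|exact: mu_summable].
Qed.

(** With [P(t)] the sum of the [p n * t ^+ n.+1], this plays the role of bounding the integral of
    [f P] by [M] times that of [|P|], up to the factor 2, with only moments in the statement. *)
Lemma DH_sum_le (f : R[i] -> R[i]) (a p : nat -> R[i]) (h : R -> R) (M : R) (N : nat) :
  has_expansion f a -> (forall z, unit_disc z -> modulus (f z) <= M) ->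
  mu.-integrable I01 (EFin \o h) ->
  (forall t, 0 <= t < 1 -> modulus (\sum_(n < N) p n * (t ^+ n.+1)%:C%C) <= h t) ->
  modulus (\sum_(n < N) p n * limn (DH_inner mu a n.+1))
    <= 2 * (M * \int[mu]_(t in I01) h t).
Proof.
move=> fa fM hi ph; have aM k : modulus (a k) <= M := cauchy_estimate k fa fM.
have M0 : 0 <= M := le_trans (modulus_ge0 _) (aM 0%N).
(* The inverse square makes [L (1 - r L)] at most [1 / (L + 1)]. *)
pose r L : R := 1 - L.+1%:R^-1 ^+ 2 / 2.
have Lpos L : 0 < L.+1%:R :> R by [].
have L1 L : L.+1%:R^-1 ^+ 2 <= 1 :> R.
  by rewrite exprn_ile1 ?invr_ge0 // invf_le1 // ler1n.
have L2 L : 0 < L.+1%:R^-1 ^+ 2 :> R by rewrite exprn_gt0 // invr_gt0.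
have r0 L : 0 <= r L by move: (L1 L); rewrite /r; set x := _ ^+ 2; lra.
have r1 L : r L < 1 by move: (L2 L); rewrite /r; set x := _ ^+ 2; lra.
have rL L : L%:R * (1 - r L) <= L.+1%:R^-1.
  rewrite /r opprB addrC subrK.
  apply: (@le_trans _ _ (L.+1%:R * L.+1%:R^-1 ^+ 2)).
    apply: ler_pM => //; try (by rewrite ler_nat leqnSn);
      by move: (L2 L); set x := _ ^+ 2; lra.
  by rewrite expr2 mulrA divff ?gt_eqF // mul1r.
have lim : (fun L => \sum_(n < N) p n * limn (DH_inner mu (fun k => a k * (r L ^+ k)%:C%C) n.+1))
    @ \oo --> \sum_(n < N) p n * limn (DH_inner mu a n.+1).
  apply: cvg_big => [|n _]; first exact: add_continuous.
  apply: cvgM; first exact: cvg_cst.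
  by apply: (@DH_inner_dilation_cvg a M r n.+1 aM) => // L; rewrite r0 ltW.
apply: (modulus_lim_le lim) => L.
have arM k : modulus (a k * (r L ^+ k)%:C%C) <= M.
  rewrite modulusM modulus_real ger0_norm ?exprn_ge0 //.
  by rewrite -[leRHS]mulr1 ler_pM ?modulus_ge0 ?exprn_ge0 // exprn_ile1 // ltW.
(* By Cauchy's estimate the terms of [f(r L * t)] are dominated by [M * r L ^+ k], whatever [t] is;
   the tail of this geometric series serves as [tau]. *)
have /cvg_ex[/= x hx] : cvgn (series (geometric M (r L))).
  by apply: is_cvg_geometric_series; rewrite ger0_norm.
apply: (@DH_sum_le_uniform (fun k => a k * (r L ^+ k)%:C%C) p h M
  (fun K => x - series (geometric M (r L)) K) N _ _ _ hi ph).
- by move=> n; exact: DH_inner_cvg arM.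
- by rewrite -(subrr x); apply: cvgB => //; exact: cvg_cst.
move=> K t /andP[t0 t1]; set y := (r L * t)%:C%C.
have y1 : modulus y <= r L.
  by rewrite modulus_real ger0_norm ?mulr_ge0 // ler_piMr // ltW.
have yD : unit_disc y by rewrite in_disc (le_lt_trans y1).
have -> : \sum_(k < K) a k * (r L ^+ k)%:C%C * (t ^+ k)%:C%C = series (fun k => a k * y ^+ k) K.
  rewrite /series /= big_mkord; apply: eq_bigr => k _.
  by rewrite -mulrA -rmorphM /= -exprMn -rmorphXn.
have tail : modulus (f y - series (fun k => a k * y ^+ k) K) <= x - series (geometric M (r L)) K.
  apply: (modulus_series_tail_le _ hx); last exact: fa.
  move=> k; rewrite modulusM modulusX ler_pM ?modulus_ge0 ?exprn_ge0 ?modulus_ge0 //.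
  by rewrite lerXn2r ?nnegrE ?modulus_ge0.
rewrite -(subrK (f y) (series _ K)) addrC (le_trans (modulusD _ _)) // lerD ?fM //.
by rewrite modulus_distC.
Qed.

End InnerSums.

(** * The bound on the derivative *)

Section DerivativeBound.
Context {R : realType}.

Lemma pow2_floor (y : R) : 1 <= y -> exists k, 2 ^+ k <= y /\ y < 2 ^+ k.+1.
Proof.
move=> y1; have ex : exists n, y < 2 ^+ n.
  exists (Num.truncn y).+1; rewrite (lt_le_trans (truncnS_gt y)) //.
  by rewrite -natrX ler_nat ltnW // ltn_expl.
case: (ex_minnP ex) => [[|k]] yk kmin; first by move: yk; rewrite expr0 ltNge y1.
exists k; split => //; rewrite leNgt; apply/negP => h.
by have := kmin _ h; rewrite ltnn.
Qed.

(** These cap [1 / |1 - t z|] by both [1 / (1 - t)] and [2 / |1 - z|], the two conditions under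
    which the dyadic majorant applies. *)
Lemma onem_le_modulus (z : R[i]) (t : R) : unit_disc z -> 0 <= t < 1 ->
  1 - t <= modulus (1 - t%:C%C * z) /\ modulus (1 - z) <= 2 * modulus (1 - t%:C%C * z).
Proof.
rewrite in_disc => z1 /andP[t0 t1].
have h : 1 - t <= modulus (1 - t%:C%C * z).
  rewrite (le_trans _ (modulusB_ge _ _)) // modulus1 lerB // modulusM modulus_real.
  by rewrite ger0_norm // ler_piMr // ltW.
split => //; rewrite (_ : 1 - z = (1 - t%:C%C * z) - (1 - t)%:C%C * z); last first.
  by rewrite rmorphB rmorph1 /=; ring.
rewrite (le_trans (modulusB_le _ _)) // mulr_natl mulr2n lerD2l (le_trans _ h) //.
by rewrite modulusM modulus_real ger0_norm ?ler_piMr ?subr_ge0 // ltW.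
Qed.

Variable mu : {finite_measure set (measurableTypeR R) -> \bar R}.
Variable C : R.
Hypothesis mu_tail : forall s : R, 0 < s -> fine (mu `[1 - s, 1%R[%classic) <= C * s ^+ 2.

Local Notation I01 := (`[0%R, 1%R[%classic : set (measurableTypeR R)).

Definition DH_coef (a : nat -> R[i]) n : R[i] := limn (DH_inner mu a n) * n.+1%:R.

Lemma DHE a : DH mu a = power_sum (DH_coef a).
Proof. by []. Qed.

Lemma DH_coef_le (a : nat -> R[i]) (M : R) n : (forall k, modulus (a k) <= M) ->
  modulus (DH_coef a n) <= M * (5 * C) * n.+1%:R.
Proof.
move=> aM; have M0 : 0 <= M := le_trans (modulus_ge0 _) (aM 0%N).
rewrite modulusM modulus_nat ler_wpM2r //.
have cvgb : cvgn (DH_inner mu a n) by apply: DH_inner_cvg aM; exact: moment_summable mu_tail.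
apply: (modulus_lim_le cvgb) => K; rewrite (le_trans (modulus_sum _ _ _)) //.
apply: (@le_trans _ _ (M * series (moment mu) K)); last first.
  by rewrite ler_wpM2l // moment_series_le.
rewrite /series /= big_distrr /=; apply: ler_sum => k _.
rewrite modulusM modulus_real ger0_norm ?moment_ge0 // mulrC.
by rewrite ler_pM ?modulus_ge0 ?moment_ge0 // moment_nonincreasing // leq_addl.
Qed.

Lemma DH_derivative_le (f : R[i] -> R[i]) (a : nat -> R[i]) (M : R) (z : R[i]) :
  has_expansion f a -> (forall z, unit_disc z -> modulus (f z) <= M) -> unit_disc z ->
  modulus (derive1 (DH mu a) z) <= 144 * M * C / modulus (1 - z).
Proof.
move=> fa fM zD; have aM k : modulus (a k) <= M := cauchy_estimate k fa fM.
have M0 : 0 <= M := le_trans (modulus_ge0 _) (aM 0%N).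
have C0 := tail_const_ge0 mu_tail.
have cB n : modulus (DH_coef a n) <= M * (5 * C) * n.+1%:R by exact: DH_coef_le.
rewrite DHE (power_sum_derive1 cB zD).
have z1 : modulus z < 1 by rewrite -in_disc.
have [e e0 ke] := kernel_sum_close (modulus_ge0 z) z1.
have z1' : 0 < modulus (1 - z).
  by rewrite modulus_gt0 subr_eq0 eq_sym; apply: contraTneq z1 => ->; rewrite modulus1 ltxx.
(* Taking [K = k.+1] gives [2 / |1 - z| <= 2 ^+ K <= 4 / |1 - z|]: the lower bound makes the
   majorant valid, the upper one keeps its integral small. *)
have [|k [k1 /ltW K1]] := @pow2_floor (2 / modulus (1 - z)).
  rewrite ler_pdivlMr // mul1r (le_trans (modulusB_le _ _)) // modulus1.
  by rewrite -[2]/(1 + 1) lerD2l ltW.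
pose K := k.+1.
have K2 : 2 ^+ K <= 2 * (2 / modulus (1 - z)) by rewrite exprS ler_wpM2l.
(* Twice the majorant covers the full kernel, and [e N] the error of truncating it at [N]. *)
pose h N t := 2 * dyadic_majorant 3 K t + e N.
have hi N : mu.-integrable I01 (EFin \o h N).
  apply: integrable_add; last first.
    by apply: (@integrable_I01 _ _ _ `|e N|).
  rewrite (_ : _ \o _ = (fun t => 2%:E * (EFin \o dyadic_majorant 3 K) t))%E //.
  by apply: integrableZl => //; exact: dyadic_majorant_integrable.
have intH : \int[mu]_(t in I01) dyadic_majorant 3 K t <= 9 * C * 2 ^+ K := dyadic_majorant3_le mu_tail K.
have int2 N : \int[mu]_(t in I01) h N t <= 18 * C * 2 ^+ K + e N * fine (mu I01).
  rewrite RintegralD //; last 2 first.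
  - rewrite (_ : _ \o _ = (fun t => 2%:E * (EFin \o dyadic_majorant 3 K) t))%E //.
    by apply: integrableZl => //; exact: dyadic_majorant_integrable.
  - by apply: (@integrable_I01 _ _ _ `|e N|).
  rewrite RintegralZl //; last exact: dyadic_majorant_integrable.
  rewrite Rintegral_cst // lerD2r (_ : 18 * C * 2 ^+ K = 2 * (9 * C * 2 ^+ K)); last by ring.
  by rewrite ler_wpM2l.
pose p n : R[i] := (n.+1 * n.+2)%:R * z ^+ n.
have ph N t : 0 <= t < 1 -> modulus (\sum_(n < N) p n * (t ^+ n.+1)%:C%C) <= h N t.
  move=> t01; have /andP[t0 t1] := t01.
  have -> : \sum_(n < N) p n * (t ^+ n.+1)%:C%C = t%:C%C * kernel_sum N (t%:C%C * z).
    rewrite /kernel_sum big_distrr /=; apply: eq_bigr => n _.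
    by rewrite exprMn exprS rmorphM /= rmorphXn /=; rewrite /p; ring.
  have [b1 b2] := onem_le_modulus zD t01.
  have b0 : 0 < modulus (1 - t%:C%C * z) by rewrite (lt_le_trans _ b1) // subr_gt0.
  rewrite modulusM modulus_real ger0_norm // -[leRHS]mul1r ler_pM ?modulus_ge0 ?(ltW t1) //.
  set w := t%:C%C * z.
  have wz : modulus w <= modulus z.
    by rewrite modulusM modulus_real ger0_norm // ler_piMl ?modulus_ge0 // ltW.
  rewrite -(subrK (2 / (1 - w) ^+ 3) (kernel_sum N w)) addrC.
  rewrite (le_trans (modulusD _ _)) // lerD ?ke //.
  rewrite modulusM modulus_nat modulusV modulusX ler_wpM2l // -exprVn.
  apply: dyadic_majorant_ge => //.
  - by rewrite invr_ge0 modulus_ge0.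
  - by rewrite lef_pV2 ?posrE ?subr_gt0.
  - rewrite (le_trans _ K1) // ler_pdivlMr // mulrC ler_pdivrMr //.
have lim1 : (fun N => modulus (\sum_(n < N) p n * limn (DH_inner mu a n.+1))) @ \oo -->
   modulus (power_sum (diff_coef (DH_coef a)) z).
  apply: cvg_modulus.
  have dB3 n : modulus (diff_coef (DH_coef a) n) <= 2 * (M * (5 * C)) * n.+1%:R ^+ 3.
    exact: diff_coef_le.
  rewrite [X in X @ _ --> _](_ : _ = series (fun n => diff_coef (DH_coef a) n * z ^+ n)).
    exact: power_sum_cvg dB3 zD.
  apply/funext => N.
  rewrite /series /= big_mkord; apply: eq_bigr => n _.
  by rewrite /diff_coef /DH_coef /p natrM; ring.
have lim2 : (fun N => 2 * (M * (18 * C * 2 ^+ K + e N * fine (mu I01)))) @ \oo -->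
   2 * (M * (18 * C * 2 ^+ K + 0 * fine (mu I01))).
  apply: cvgM; first exact: cvg_cst.
  apply: cvgM; first exact: cvg_cst.
  apply: cvgD; first exact: cvg_cst.
  by apply: cvgM => //; exact: cvg_cst.
apply: (@le_trans _ _ (2 * (M * (18 * C * 2 ^+ K + 0 * fine (mu I01))))).
  apply: (ler_cvg_to lim1 lim2); apply: nearW => N.
  apply: (le_trans (DH_sum_le (moment_summable mu_tail) fa fM (hi N) (ph N))).
  by rewrite ler_wpM2l // ler_wpM2l.
rewrite mul0r addr0.
rewrite (_ : 2 * (M * (18 * C * 2 ^+ K)) = 36 * M * C * 2 ^+ K); last by ring.
(* 144 = 2 (real and imaginary parts) * 2 (numerator of the kernel) * 9 (dyadic layers) * 4 (from
   [K2]). *)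
rewrite (_ : 144 * M * C / _ = 36 * M * C * (2 * (2 / modulus (1 - z)))); last by ring.
by rewrite ler_wpM2l // !mulr_ge0.
Qed.

End DerivativeBound.

(** * The Q_p integral *)

Section PseudoHyperbolic.
Context {R : realType}.
Implicit Types w z : R[i].

Definition gap w z : R := 1 - modulus (sigma w z) ^+ 2.

Lemma modulus_onem_conj w z :
  modulus (1 - w^* * z) ^+ 2 - modulus (w - z) ^+ 2
    = (1 - modulus w ^+ 2) * (1 - modulus z ^+ 2).
Proof. by rewrite !modulus_sqr; case: w => a b; case: z => c d /=; ring. Qed.

Lemma gapE w z : unit_disc w -> unit_disc z ->
  0 < modulus (1 - w^* * z) /\
  gap w z = (1 - modulus w ^+ 2) * (1 - modulus z ^+ 2) / modulus (1 - w^* * z) ^+ 2.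
Proof.
rewrite !in_disc => w1 z1.
have n0 : 0 < modulus (1 - w^* * z).
  rewrite (lt_le_trans _ (modulusB_ge _ _)) // modulus1 modulusM modulus_conj subr_gt0.
  by rewrite mulr_ilt1 ?modulus_ge0.
split => //; rewrite /gap -modulus_onem_conj /sigma modulusM modulusV.
by field; rewrite gt_eqF.
Qed.

Lemma onem_sqr_ge0 z : unit_disc z -> 0 <= 1 - modulus z ^+ 2.
Proof. by rewrite in_disc subr_ge0 => z1; rewrite exprn_ile1 ?modulus_ge0 // ltW. Qed.

Lemma onem_sqr_le z : unit_disc z -> 1 - modulus z ^+ 2 <= 2 * modulus (1 - z).
Proof.
rewrite in_disc => z1; have z0 := modulus_ge0 z.
have h : 1 - modulus z <= modulus (1 - z) by rewrite -{1}(@modulus1 R) modulusB_ge.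
by nra.
Qed.

Lemma gap_ge0 w z : unit_disc w -> unit_disc z -> 0 <= gap w z.
Proof.
move=> wD zD; have [n0 ->] := gapE wD zD.
by rewrite divr_ge0 ?exprn_ge0 ?modulus_ge0 // mulr_ge0 // onem_sqr_ge0.
Qed.

(** The numerator of [gap] is at most [4 |1 - z| |1 - w|], and its denominator at least the square
    of [|w - z| >= ||1 - z| - |1 - w||]. Put [x, y] for the two distances to 1: if [y <= 2 x] then
    [gap <= 1] suffices; otherwise [|x - y| >= y / 2] gives [16 x / y]. *)
Lemma gap_le_ratio w z : unit_disc w -> unit_disc z ->
  gap w z <= 16 * (modulus (1 - z) / modulus (1 - w)) /\
  gap w z <= 16 * (modulus (1 - w) / modulus (1 - z)).
Proof.
move=> wD zD; have [n0 gE] := gapE wD zD.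
have pos (v : R[i]) : unit_disc v -> 0 < modulus (1 - v).
  rewrite in_disc => v1; rewrite modulus_gt0 subr_eq0 eq_sym.
  by apply: contraTneq v1 => ->; rewrite modulus1 ltxx.
have x0 := pos _ zD; have y0 := pos _ wD.
have g1 : gap w z <= 1 by rewrite /gap gerBl sqr_ge0.
have w2 := onem_sqr_le wD; have z2 := onem_sqr_le zD.
have w0 := onem_sqr_ge0 wD; have z0 := onem_sqr_ge0 zD.
have N : modulus (w - z) ^+ 2 <= modulus (1 - w^* * z) ^+ 2.
  by rewrite -subr_ge0 modulus_onem_conj mulr_ge0.
have tri : (modulus (1 - z) - modulus (1 - w)) ^+ 2 <= modulus (w - z) ^+ 2.
  rewrite -[leLHS]real_normK ?num_real // lerXn2r ?nnegrE ?modulus_ge0 //.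
  rewrite ler_norml lerNl opprB; apply/andP; split.
    by rewrite modulus_distC (_ : z - w = (1 - w) - (1 - z)) ?modulusB_ge //; ring.
  by rewrite (_ : w - z = (1 - z) - (1 - w)) ?modulusB_ge //; ring.
have num : gap w z * modulus (1 - w^* * z) ^+ 2 <= 4 * modulus (1 - z) * modulus (1 - w).
  rewrite gE divfK ?gt_eqF ?exprn_gt0 //.
  rewrite (_ : 4 * _ * _ = (2 * modulus (1 - w)) * (2 * modulus (1 - z))); last by ring.
  by rewrite ler_pM.
have g0 := gap_ge0 wD zD.
have key (x y : R) : 0 < x -> 0 < y -> (x - y) ^+ 2 <= modulus (1 - w^* * z) ^+ 2 ->
    gap w z * modulus (1 - w^* * z) ^+ 2 <= 4 * x * y -> gap w z <= 16 * (x / y).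
  move: (gap w z) g0 g1 (modulus (1 - w^* * z) ^+ 2) => g g0 g1 n x_gt0 y_gt0 xyn gn.
  rewrite mulrA ler_pdivlMr //; have [xy|xy] := leP y (2 * x).
    by rewrite (@le_trans _ _ (1 * y)) ?ler_wpM2r ?(ltW y_gt0) // mul1r; lra.
  rewrite -(ler_pM2r y_gt0).
  have : g * (y ^+ 2 / 4) <= 4 * x * y.
    apply: le_trans gn; rewrite ler_wpM2l //; apply: le_trans xyn; nra.
  by move=> h; nra.
have D : (modulus (1 - z) - modulus (1 - w)) ^+ 2 <= modulus (1 - w^* * z) ^+ 2.
  exact: le_trans N.
split; apply: key => //; first by rewrite -sqrrN opprB.
by rewrite mulrAC.
Qed.

End PseudoHyperbolic.

(** * Area integrals over dyadic squares *)

Section AreaIntegral.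
Context {R : realType}.
Local Notation plane := (measurableTypeR R * measurableTypeR R)%type.

(* Unlike [ge0_le_integral], this assumes no measurability: the integral of a
   nonnegative function is a supremum over simple functions below it. *)
Lemma ge0_le_integral_nonmeas d (T : measurableType d) (nu : {measure set T -> \bar R})
    (f g : T -> \bar R) :
  (forall x, (0 <= f x)%E) -> (forall x, (f x <= g x)%E) ->
  (\int[nu]_x f x <= \int[nu]_x g x)%E.
Proof.
move=> f0 fg; have g0 x : (0 <= g x)%E by exact: le_trans (f0 x) (fg x).
rewrite ge0_integralTE // ge0_integralTE //; apply: le_ereal_sup.
by move=> _ [h /= hf <-]; exists h => // x; exact: le_trans (hf x) (fg x).
Qed.

Lemma area_rectangle (a b c d : R) : a < b -> c < d ->
  area (`[a, b]%classic `*` `[c, d]%classic) = ((b - a) * (d - c))%:E.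
Proof.
move=> ab cd; have len (x y : R) : x < y -> @lebesgue_measure R `[x, y]%classic = (y - x)%:E.
  by move=> xy; rewrite lebesgue_measure_itv /= lte_fin xy.
rewrite /area product_measure1E // EFinM.
by congr (_ * _)%E; exact: len.
Qed.

Lemma integral_scaled_indic (c : R) (B : set plane) : 0 <= c -> measurable B ->
  (\int[@area R]_u (c * \1_B u)%:E = c%:E * area B)%E.
Proof.
move=> c0 mB; rewrite /area; under eq_integral do rewrite EFinM.
rewrite ge0_integralZl_EFin //; last exact/measurable_EFinP.
by rewrite integral_indic // setIT.
Qed.

(** Squares replace the discs [|1 - z| <= s]: as products of intervals they have an immediate
    area. *)
Definition square_at_one (s : R) : set plane := `[1 - s, 1 + s]%classic `*` `[- s, s]%classic.

Lemma measurable_square s : measurable (square_at_one s).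
Proof. exact: measurableX. Qed.

Lemma integral_square (c s : R) : 0 <= c -> 0 < s ->
  (\int[@area R]_u (c * \1_(square_at_one s) u)%:E = (c * (4 * s ^+ 2))%:E)%E.
Proof.
move=> c0 s0; rewrite integral_scaled_indic //; last exact: measurable_square.
rewrite area_rectangle; [|lra|lra].
by rewrite -EFinM; congr EFin; ring.
Qed.

Lemma in_square (u : R * R) (s : R) : modulus (1 - cplx u) <= s -> square_at_one s u.
Proof.
move=> us; have := le_trans (normRe_le_modulus _) us; have := le_trans (normIm_le_modulus _) us.
case: u {us} => a b /=; rewrite sub0r normrN !ler_norml => /andP[b1 b2] /andP[a1 a2].
by split; rewrite /= in_itv /=; apply/andP; split; lra.
Qed.

Variables (p : R) (p_gt0 : 0 < p).
Let q : R := 2^-1 `^ p.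

Lemma half_powR_lt1 : 0 <= q /\ q < 1.
Proof.
split; first exact: powR_ge0.
have <- : 1 `^ p = 1 :> R by rewrite powR1.
by apply: gt0_ltr_powR => //; rewrite ?nnegrE ?invr_ge0 // invf_lt1 // ltr1n.
Qed.

(** The first summand serves [|1 - z| <= |1 - w|], where [|1 - z|] is between [eta 2^-k / 2] and
    [eta 2^-k], whence the 4; the second serves the points farther out, with [|1 - z|] between
    [eta 2^k] and [eta 2^(k+1)]. The factor [q ^+ k] bounds the power [p] of the ratio of the two
    distances. *)
Definition dyadic_term (L eta : R) k (u : plane) : R :=
  (4 * L * q ^+ k / (eta * 2^-1 ^+ k) ^+ 2) * \1_(square_at_one (eta * 2^-1 ^+ k)) u
  + (L * q ^+ k / (eta * 2 ^+ k) ^+ 2) * \1_(square_at_one (eta * 2 ^+ k.+1)) u.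

Lemma dyadic_term_ge0 L eta k u : 0 <= L -> 0 <= dyadic_term L eta k u.
Proof.
move=> L0; have [q0 _] := half_powR_lt1.
by rewrite addr_ge0 // mulr_ge0 // divr_ge0 ?sqr_ge0 // !mulr_ge0 ?exprn_ge0.
Qed.

Lemma measurable_dyadic_term L eta k : measurable_fun setT (dyadic_term L eta k).
Proof.
by apply: measurable_funD; apply: measurable_funM => //;
  apply: measurable_indic; exact: measurable_square.
Qed.

(** The area of each square cancels the square of its scale, so each summand gives [16 L q ^+ k] for
    every [eta]; hence the uniformity in [w]. *)
Lemma integral_dyadic_term L eta k : 0 <= L -> 0 < eta ->
  (\int[@area R]_u (dyadic_term L eta k u)%:E = (32 * L * q ^+ k)%:E)%E.
Proof.
move=> L0 eta0; have [q0 _] := half_powR_lt1.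
have s1 : 0 < eta * 2^-1 ^+ k by rewrite mulr_gt0 // exprn_gt0 // invr_gt0.
have s2 : 0 < eta * 2 ^+ k.+1 by rewrite mulr_gt0 // exprn_gt0.
have s3 : 0 < eta * 2 ^+ k by rewrite mulr_gt0 // exprn_gt0.
have c1 : 0 <= 4 * L * q ^+ k / (eta * 2^-1 ^+ k) ^+ 2.
  by rewrite divr_ge0 ?sqr_ge0 // !mulr_ge0 ?exprn_ge0.
have c2 : 0 <= L * q ^+ k / (eta * 2 ^+ k) ^+ 2.
  by rewrite divr_ge0 ?sqr_ge0 // !mulr_ge0 ?exprn_ge0.
have meas (c s : R) : measurable_fun setT (fun u : plane => (c * \1_(square_at_one s) u)%:E).
  by apply/measurable_EFinP; apply: measurable_funM => //; apply: measurable_indic;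
    exact: measurable_square.
rewrite /dyadic_term; under eq_integral do rewrite EFinD.
rewrite /area ge0_integralD //; last 2 first.
- by move=> u _; rewrite lee_fin mulr_ge0.
- by move=> u _; rewrite lee_fin mulr_ge0.
rewrite -/(@area R) !integral_square // -EFinD; congr EFin.
rewrite [eta * 2 ^+ k.+1](_ : _ = 2 * (eta * 2 ^+ k)); last by rewrite exprS; ring.
by field; rewrite !gt_eqF.
Qed.

Lemma dyadic_series_le (r B : R) : 0 <= r -> r < 1 -> 0 <= B ->
  (\sum_(0 <= k <oo) (B * r ^+ k)%:E <= (B / (1 - r))%:E)%E.
Proof.
move=> r0 r1 B0; apply: lime_le.
  by apply: is_cvg_nneseries => k _ _; rewrite lee_fin mulr_ge0 // exprn_ge0.
apply: nearW => n; rewrite sumEFin lee_fin -big_distrr /= ler_wpM2l // big_mkord.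
rewrite -[leRHS]mul1r ler_pdivlMr ?subr_gt0 // mulrC.
by rewrite -opprB mulNr -subrX1 opprB gerBl exprn_ge0.
Qed.

(* Scale invariance in [|1 - z| / |1 - w|]: with [rho = |1 - z|] and
   [eta = |1 - w|] the integrand is at most
   [16^p rho^-2 min (rho / eta, eta / rho)^p]. *)
Lemma integrand_le_dyadic (A : R) (w z : R[i]) (x : R) : unit_disc w -> unit_disc z ->
  0 <= x -> x <= A / modulus (1 - z) ->
  exists k, forall u, cplx u = z ->
  x ^+ 2 * gap w z `^ p <= dyadic_term (A ^+ 2 * 16 `^ p) (modulus (1 - w)) k u.
Proof.
move=> wD zD x0 xA; have [q0 q1] := half_powR_lt1.
have pos (v : R[i]) : unit_disc v -> 0 < modulus (1 - v).
  rewrite in_disc => v1; rewrite modulus_gt0 subr_eq0 eq_sym.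
  by apply: contraTneq v1 => ->; rewrite modulus1 ltxx.
have r0 := pos _ zD; have e0 := pos _ wD.
have [g1 g2] := gap_le_ratio wD zD.
have pk k y : gap w z <= 16 * y -> y <= 2^-1 ^+ k -> gap w z `^ p <= 16 `^ p * q ^+ k.
  move=> gy yk; rewrite /q -powR_mulrn ?powR_ge0 // powRAC powR_mulrn ?invr_ge0 //.
  rewrite -powRM ?exprn_ge0 ?invr_ge0 //; apply: ge0_ler_powR; rewrite ?nnegrE ?(ltW p_gt0) //.
    exact: gap_ge0.
  by rewrite (le_trans gy) // ler_wpM2l.
have x2 (s : R) : 0 < s -> s <= modulus (1 - z) -> x ^+ 2 <= A ^+ 2 / s ^+ 2.
  move=> s0 sr; rewrite -expr_div_n lerXn2r ?nnegrE //.
    rewrite divr_ge0 ?(ltW s0) //.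
    by have := le_trans x0 xA; rewrite pmulr_lge0 // invr_gt0.
  rewrite (le_trans xA) // ler_wpM2l //.
    by have := le_trans x0 xA; rewrite pmulr_lge0 // invr_gt0.
  by rewrite lef_pV2.
have ind0 c s u : 0 <= c -> 0 <= c * \1_(square_at_one s) u :> R by move=> ?; rewrite mulr_ge0.
have L0 : 0 <= A ^+ 2 * 16 `^ p by rewrite mulr_ge0 ?sqr_ge0 ?powR_ge0.
have coef0 k (c s : R) : 0 <= c -> 0 <= c * q ^+ k / s ^+ 2.
  by move=> c0; rewrite divr_ge0 ?sqr_ge0 // mulr_ge0 // exprn_ge0.
(* In either case [k] is fixed by the ratio of the larger distance to the smaller one lying in
   [[2^k, 2^(k+1))]. *)
have [re|re] := leP (modulus (1 - z)) (modulus (1 - w)).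
  have [|k [k1 k2]] := @pow2_floor _ (modulus (1 - w) / modulus (1 - z)).
    by rewrite ler_pdivlMr // mul1r.
  have rk : modulus (1 - z) <= modulus (1 - w) * 2^-1 ^+ k.
    by rewrite exprVn ler_pdivlMr ?exprn_gt0 // mulrC -ler_pdivlMr.
  have rk' : modulus (1 - w) * 2^-1 ^+ k / 2 <= modulus (1 - z).
    move: k2; rewrite ltr_pdivrMr // exprS => /ltW h.
    rewrite exprVn !ler_pdivrMr ?exprn_gt0 //.
    by rewrite (_ : _ * 2 * _ = 2 * 2 ^+ k * modulus (1 - z)) //; ring.
  exists k => u uz; rewrite /dyadic_term -[leLHS]addr0 lerD //; last first.
    by apply: ind0; exact: coef0.
  rewrite indicE mem_set ?mulr1; last by apply: in_square; rewrite uz.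
  set s := modulus (1 - w) * 2^-1 ^+ k in rk rk' *.
  have s0 : 0 < s by rewrite mulr_gt0 // exprn_gt0 // invr_gt0.
  rewrite (_ : _ / s ^+ 2 = A ^+ 2 / (s / 2) ^+ 2 * (16 `^ p * q ^+ k)); last first.
    by field; rewrite gt_eqF.
  apply: ler_pM; rewrite ?sqr_ge0 ?powR_ge0 //; first by apply: x2; rewrite ?divr_gt0.
  apply: (pk _ _ g1); rewrite ler_pdivrMr // mulrC; exact: rk.
have [|k [k1 k2]] := @pow2_floor _ (modulus (1 - z) / modulus (1 - w)).
  by rewrite ler_pdivlMr // mul1r ltW.
have rk : modulus (1 - w) * 2 ^+ k <= modulus (1 - z) by move: k1; rewrite ler_pdivlMr // mulrC.
have rk' : modulus (1 - z) <= modulus (1 - w) * 2 ^+ k.+1.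
  by move: k2; rewrite ltr_pdivrMr // mulrC => /ltW.
exists k => u uz; rewrite /dyadic_term -[leLHS]add0r lerD //.
  by apply: ind0; apply: coef0; rewrite mulr_ge0.
rewrite indicE mem_set ?mulr1; last by apply: in_square; rewrite uz.
have s0 : 0 < modulus (1 - w) * 2 ^+ k by rewrite mulr_gt0 // exprn_gt0.
rewrite [leRHS](_ : _ = A ^+ 2 / (modulus (1 - w) * 2 ^+ k) ^+ 2 * (16 `^ p * q ^+ k)); last by ring.
apply: ler_pM; rewrite ?sqr_ge0 ?powR_ge0 //; first exact: x2.
by apply: (pk _ _ g2); rewrite ler_pdivrMr // exprVn mulrC ler_pdivlMr ?exprn_gt0.
Qed.

Lemma Qp_integral_le (f : R[i] -> R[i]) (A : R) (w : R[i]) : unit_disc w ->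
  (forall z, unit_disc z -> modulus (derive1 f z) <= A / modulus (1 - z)) ->
  (Qp_integral p f w <= (32 * (A ^+ 2 * 16 `^ p) / (1 - q))%:E)%E.
Proof.
move=> wD fA; set L := A ^+ 2 * 16 `^ p.
have L0 : 0 <= L by rewrite mulr_ge0 ?sqr_ge0 ?powR_ge0.
have [q0 q1] := half_powR_lt1.
have e0 : 0 < modulus (1 - w).
  move: (wD); rewrite in_disc => w1; rewrite modulus_gt0 subr_eq0 eq_sym.
  by apply: contraTneq w1 => ->; rewrite modulus1 ltxx.
(* Adding up all the terms removes the dependence of [k] on the point, and the sum can be integrated
   term by term. *)
pose G (u : plane) : \bar R := (\sum_(0 <= k <oo) (dyadic_term L (modulus (1 - w)) k u)%:E)%E.
have G0 u : (0 <= G u)%E.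
  by apply: nneseries_ge0 => k _ _; rewrite lee_fin dyadic_term_ge0.
apply: (@le_trans _ _ (\int[@area R]_u G u)%E); last first.
  rewrite /area integral_nneseries //; last 2 first.
  - by move=> k; apply/measurable_EFinP; exact: measurable_dyadic_term.
  - by move=> k u _; rewrite lee_fin dyadic_term_ge0.
  under eq_eseriesr do rewrite -/(@area R) integral_dyadic_term //.
  by apply: dyadic_series_le => //; rewrite mulr_ge0.
rewrite /Qp_integral integral_mkcond /area; apply: ge0_le_integral_nonmeas => //.
  by move=> u; rewrite patchE; case: ifP => // _; rewrite lee_fin mulr_ge0 ?sqr_ge0 ?powR_ge0.
move=> u; rewrite patchE; case: ifPn => // /set_mem uD.
have [k hk] := integrand_le_dyadic wD uD (modulus_ge0 _) (fA _ uD).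
apply: (@le_trans _ _ (dyadic_term L (modulus (1 - w)) k u)%:E).
  by rewrite lee_fin; exact: hk.
rewrite /G (@le_trans _ _ (\sum_(0 <= j < k.+1) (dyadic_term L (modulus (1 - w)) j u)%:E)%E) //.
  rewrite big_nat_recr //= -[leLHS]add0e leeD2r //.
  by apply: sume_ge0 => j _; rewrite lee_fin dyadic_term_ge0.
by apply: nneseries_lim_ge => j _ _; rewrite lee_fin dyadic_term_ge0.
Qed.

End AreaIntegral.

(** * The image of the constant function 1 *)

Section LowerBound.
Context {R : realType}.
Variable mu : {finite_measure set (measurableTypeR R) -> \bar R}.

Local Notation I01 := (`[0%R, 1%R[%classic : set (measurableTypeR R)).
Local Notation delta0 := (fun k : nat => (k == 0%N)%:R : R[i]).

Lemma has_expansion_cst1 : has_expansion (fun=> 1) delta0.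
Proof.
move=> z _; rewrite -(cvg_shiftS (series _)); apply: cvg_near_cst; apply: nearW => n.
rewrite /series /= big_nat_recl //= expr0 mulr1 big1 ?addr0 // => k _.
by rewrite mul0r.
Qed.

Lemma DH_inner_delta0 n : DH_inner mu delta0 n @ \oo --> (moment mu n)%:C%C.
Proof.
rewrite /DH_inner -(cvg_shiftS (series _)); apply: cvg_near_cst; apply: nearW => k.
rewrite /series /= big_nat_recl //= addn0 mulr1 big1 ?addr0 // => j _.
by rewrite mulr0.
Qed.

Lemma DH_coef_delta0 n : DH_coef mu delta0 n = (moment mu n)%:C%C * n.+1%:R.
Proof. by rewrite /DH_coef (cvgC_lim (@DH_inner_delta0 n)). Qed.

(* The real part of a cube [(u + i v)^3] with [|v| <= u / 2] is at least
   [u^3 / 4]. *)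
Lemma Re_inv_cube_ge (w : R[i]) (A : R) : 0 < Re w -> Re w <= A ->
  2 * `|Im w| <= Re w -> (4 / 5 / A) ^+ 3 / 4 <= Re (w^-1 ^+ 3).
Proof.
case: w => a b; rewrite [Re (_ +i* _)%C]/= [Im _]/= => a0 aA ba.
have b2 : 4 * b ^+ 2 <= a ^+ 2.
  have : (2 * `|b|) ^+ 2 <= a ^+ 2 by rewrite lerXn2r ?nnegrE ?mulr_ge0 // ltW.
  by rewrite exprMn real_normK ?num_real // -natrX.
set n := a ^+ 2 + b ^+ 2; have n0 : 0 < n by rewrite ltr_wpDr ?sqr_ge0 // exprn_gt0.
have A0 : 0 < A by exact: lt_le_trans aA.
rewrite (_ : Re _ = (a / n) ^+ 3 - 3 * (a / n) * (b / n) ^+ 2); last by rewrite /= -/n; ring.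
(* [n <= 5/4 a^2], so [a / n >= 4 / (5 a) >= 4 / (5 A)]; here [a / n] and [- b / n] are the real and
   imaginary parts of [w^-1]. *)
have un : 4 / 5 / A <= a / n.
  rewrite ler_pdivlMr // mulrAC ler_pdivrMr // /n; nra.
have v2 : 4 * (b / n) ^+ 2 <= (a / n) ^+ 2.
  by rewrite !expr_div_n mulrA ler_wpM2r ?invr_ge0 ?sqr_ge0.
have u0 : 0 <= 4 / 5 / A by rewrite !divr_ge0 // ltW.
have u3 : (4 / 5 / A) ^+ 3 <= (a / n) ^+ 3 by rewrite lerXn2r ?nnegrE // (le_trans u0).
move: (a / n) (b / n) (4 / 5 / A) un v2 u0 u3 => u v s su v2 s0 u3.
have : 0 <= u * (u ^+ 2 - 4 * v ^+ 2).
  by apply: mulr_ge0; [exact: le_trans su|rewrite subr_ge0].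
rewrite mulrBr -exprS => h; lra.
Qed.

(** The half-height [(1 - x) / 2] ensures [2 |Im (1 - t z)| <= 1 - x <= Re (1 - t z)], the sector in
    which the inverse cube has positive real part; the second inequality uses that the box lies to
    the left of [x]. *)
Definition box (x : R) : set (measurableTypeR R * measurableTypeR R) :=
  `[x - (1 - x) / 2, x]%classic `*` `[- ((1 - x) / 2), (1 - x) / 2]%classic.

Lemma area_box (x c : R) : x < 1 -> 0 <= c ->
  (\int[@area R]_u (c * \1_(box x) u)%:E = (c * ((1 - x) ^+ 2 / 2))%:E)%E.
Proof.
move=> x1 c0; rewrite integral_scaled_indic //; last exact: measurableX.
rewrite area_rectangle; [|lra|lra].
by rewrite -EFinM; congr EFin; field.
Qed.

Lemma box_in (x : R) (u : R * R) : box x u ->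
  [/\ x - (1 - x) / 2 <= u.1, u.1 <= x & `|u.2| <= (1 - x) / 2].
Proof.
by case=> /=; rewrite !in_itv /= => /andP[h1 h2] /andP[h3 h4]; rewrite ler_norml h3.
Qed.

Lemma box_disc (x : R) (u : R * R) : 1 / 2 <= x -> x < 1 -> box x u -> unit_disc (cplx u).
Proof.
move=> x2 x1 /box_in[a1 a2]; rewrite ler_norml => /andP[b1 b2].
rewrite in_disc -(@ltr_pXn2r _ 2) ?nnegrE ?modulus_ge0 // modulus_sqr /=.
rewrite expr1n; nra.
Qed.

(** With [d = 1 - x], the numerator is at least [d^2] and [|1 - x z|^2] at most [(25/4 + 1/4) d^2];
    1/8 is below 2/13. *)
Lemma gap_box_ge (x : R) (u : R * R) : 1 / 2 <= x -> x < 1 -> box x u ->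
  1 / 8 <= gap x%:C%C (cplx u).
Proof.
move=> x2 x1 ux; have xD : unit_disc x%:C%C.
  by rewrite in_disc modulus_real ger0_norm //; lra.
have [n0 ->] := gapE xD (box_disc x2 x1 ux).
rewrite ler_pdivlMr ?exprn_gt0 // !modulus_sqr.
case: u ux n0 => a b /box_in[/= a1 a2]; rewrite ler_norml => /andP[b1 b2] _.
rewrite /= [leLHS](_ : _ = 1 / 8 * ((1 - x * a) ^+ 2 + (x * b) ^+ 2)); last by ring.
rewrite [leRHS](_ : _ = (1 - x ^+ 2) * (1 - a ^+ 2 - b ^+ 2)); last by ring.
have b2' : b ^+ 2 <= (1 - x) ^+ 2 / 4 by nra.
have a0 : 0 <= a by lra.
have u1 : (1 - x * a) ^+ 2 <= (5 / 2 * (1 - x)) ^+ 2.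
  by rewrite lerXn2r ?nnegrE; nra.
have u2 : (x * b) ^+ 2 <= (1 - x) ^+ 2 / 4.
  by rewrite exprMn (le_trans _ b2') // ler_piMl ?sqr_ge0 //; nra.
have v1 : 1 - x <= 1 - x ^+ 2 by nra.
have v2 : 1 - x <= 1 - a ^+ 2 - b ^+ 2 by nra.
apply: (@le_trans _ _ ((1 - x) * (1 - x))); first by nra.
by apply: ler_pM => //; lra.
Qed.

Lemma moment_le0 n : moment mu n <= moment mu 0.
Proof. exact: moment_nonincreasing. Qed.

Lemma DH_coef_delta0_le n : modulus (DH_coef mu delta0 n) <= moment mu 0 * n.+1%:R.
Proof.
rewrite DH_coef_delta0 modulusM modulus_real modulus_nat ger0_norm ?moment_ge0 //.
by rewrite ler_wpM2r // moment_le0.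
Qed.

(** For [t >= x] the real part of [1 - t z] is at most [5/2 (1 - x)], which gives the constant
    128/15625, above 1/200, and [2 t >= 1]. For [t < x] only the sign matters, so [A] is taken to be
    the real part itself. *)
Lemma Re_kernel_ge (x t : R) (u : R * R) : 1 / 2 <= x -> x < 1 -> box x u -> 0 <= t < 1 ->
  (1 - x)^-1 ^+ 3 / 200 * \1_(`[x, 1[%classic : set R) t
    <= Re (t%:C%C * (2 / (1 - t%:C%C * cplx u) ^+ 3)).
Proof.
move=> x2 x1 ux /andP[t0 t1]; have [a1 a2 b1] := box_in ux.
case: u ux a1 a2 b1 => a b ux a1 a2 b1; rewrite /= in a1 a2 b1.
set w := 1 - t%:C%C * cplx (a, b).
have Rw : Re w = 1 - t * a by rewrite /w /=; ring.
have Iw : Im w = - (t * b) by rewrite /w /=; ring.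
have a0 : 0 <= a by lra.
have Rw0 : 0 < Re w by rewrite Rw; nra.
have Rwd : 1 - x <= Re w by rewrite Rw; nra.
have Iw2 : 2 * `|Im w| <= Re w.
  rewrite Iw normrN normrM (ger0_norm t0) (le_trans _ Rwd) //.
  have : t * `|b| <= `|b| by rewrite ler_piMl // ltW.
  by move=> h; lra.
rewrite (_ : t%:C%C * (2 / w ^+ 3) = w^-1 ^+ 3 * (2 * t)%:C%C); last first.
  by rewrite exprVn rmorphM rmorph_nat /=; ring.
rewrite Re_scale indicE; have [tx|tx] := leP x t; last first.
  rewrite memNset ?mulr0; last by rewrite /= in_itv /= leNgt tx.
  rewrite mulr_ge0 ?mulr_ge0 // (le_trans _ (Re_inv_cube_ge Rw0 (lexx _) Iw2)) //.
  by rewrite divr_ge0 // exprn_ge0 // !divr_ge0 // ltW.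
rewrite mem_set ?mulr1; last by rewrite /= in_itv /= tx.
have d0 : 0 < 1 - x by rewrite subr_gt0.
have RwU : Re w <= 5 / 2 * (1 - x) by rewrite Rw; nra.
have := Re_inv_cube_ge Rw0 RwU Iw2; move: (Re (w^-1 ^+ 3)) => r.
have -> : (4 / 5 / (5 / 2 * (1 - x))) ^+ 3 = 512 / 15625 * (1 - x)^-1 ^+ 3.
  by field; rewrite gt_eqF.
have : 0 <= (1 - x)^-1 ^+ 3 by rewrite exprn_ge0 // invr_ge0 ltW.
move: (_ ^+ 3) => y y0 ry.
have : 1 <= 2 * t by lra.
move: (2 * t) => s s1; nra.
Qed.

Lemma DH_delta0_derivative_ge (x : R) (u : R * R) : 1 / 2 <= x -> x < 1 -> box x u ->
  (1 - x)^-1 ^+ 3 / 200 * fine (mu `[x, 1%R[%classic)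
    <= modulus (derive1 (DH mu delta0) (cplx u)).
Proof.
move=> x2 x1 ux; have zD := box_disc x2 x1 ux; set z := cplx u in zD *.
rewrite DHE (power_sum_derive1 DH_coef_delta0_le zD).
have dB3 n := diff_coef_le n DH_coef_delta0_le.
apply: (le_trans _ (le_trans (ler_norm _) (normRe_le_modulus _))).
have /cvgC_ReIm[lim1 _] := power_sum_cvg dB3 zD.
have z1 : modulus z < 1 by rewrite -in_disc.
have [e e0 ke] := kernel_sum_close (modulus_ge0 z) z1.
set c := (1 - x)^-1 ^+ 3 / 200; set m := fine _.
(* Replacing the kernel by its truncation costs at most [e N] times the mass of [[0, 1)], which
   vanishes in the limit. *)
have lim2 : (fun N => c * m - e N * fine (mu I01)) @ \oo --> c * m - 0 * fine (mu I01).
  by apply: cvgB; [exact: cvg_cst|apply: cvgM => //; exact: cvg_cst].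
rewrite -[leLHS]subr0 -(mul0r (fine (mu I01))).
apply: (ler_cvg_to lim2 lim1); apply: nearW => N.
pose d (n : 'I_N) := Re ((n.+1 * n.+2)%:R * z ^+ n).
have [ci cE] := moment_sum mu (index_enum 'I_N) d (fun n => n.+1).
have -> : Re (series (fun n => diff_coef (DH_coef mu delta0) n * z ^+ n) N)
    = \sum_(n < N) d n * moment mu n.+1.
  rewrite /series /= big_mkord Re_sum; apply: eq_bigr => n _.
  rewrite -Re_scale /diff_coef DH_coef_delta0; congr Re.
  by rewrite natrM; ring.
rewrite cE.
have mx : measurable (`[x, 1[%classic : set (measurableTypeR R)) by [].
have i1 := integrable_indicator mu c mx.
have i2 : mu.-integrable I01 (EFin \o (fun=> e N)).
  by apply: (@integrable_I01 _ _ _ `|e N|).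
have cm : \int[mu]_(t in I01) (c * \1_(`[x, 1[%classic : set R) t - e N)
    = c * m - e N * fine (mu I01).
  rewrite RintegralB // Rintegral_indicator // Rintegral_cst //.
  by rewrite setIidl //; apply: subset_itvr; rewrite bnd_simp; lra.
have i3 : mu.-integrable I01 (EFin \o (fun=> - e N)).
  by apply: (@integrable_I01 _ _ _ `|- e N|).
rewrite -cm; apply: le_Rintegral; [by []|exact: (integrable_add i1 i3)|exact: ci|].
move=> t; rewrite I01E => t01; have /andP[t0 t1] := t01.
rewrite lerBlDr (le_trans (Re_kernel_ge x2 x1 ux t01)) //.
have -> : \sum_(n < N) d n * t ^+ n.+1 = Re (t%:C%C * kernel_sum N (t%:C%C * z)).
  rewrite /kernel_sum big_distrr /= Re_sum; apply: eq_bigr => n _.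
  rewrite -Re_scale; congr Re.
  by rewrite exprMn exprS rmorphM /= rmorphXn /=; ring.
rewrite -lerBlDl -ReE_sub -mulrBr (le_trans (le_trans (ler_norm _) (normRe_le_modulus _))) //.
have wz : modulus (t%:C%C * z) <= modulus z.
  by rewrite modulusM modulus_real ger0_norm // ler_piMl ?modulus_ge0 // ltW.
rewrite modulusM modulus_real ger0_norm // -[leRHS]mul1r ler_pM ?modulus_ge0 ?(ltW t1) //.
by rewrite modulus_distC ke.
Qed.

(** With [d = 1 - x] and [m] the tail mass, the box alone contributes
    [(m d^-3 / 200)^2 * 8^-p * d^2 / 2] to the integral; solving for [m^2] leaves [d^4]. *)
Lemma tail_sqr_le (p B x : R) : 0 < p -> 1 / 2 <= x -> x < 1 ->
  (Qp_integral p (DH mu delta0) x%:C%C <= B%:E)%E ->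
  fine (mu `[x, 1%R[%classic) ^+ 2 <= 2 * 200 ^+ 2 * 8 `^ p * B * (1 - x) ^+ 4.
Proof.
move=> p0 x2 x1; set m := fine _.
have m0 : 0 <= m by rewrite fine_ge0.
have d0 : 0 < 1 - x by rewrite subr_gt0.
set c := (1 - x)^-1 ^+ 3 / 200.
have c0 : 0 <= c by rewrite divr_ge0 // exprn_ge0 // invr_ge0 ltW.
pose k := (c * m) ^+ 2 * (1 / 8) `^ p.
have k0 : 0 <= k by rewrite mulr_ge0 ?sqr_ge0 ?powR_ge0.
move=> QB; have : (\int[@area R]_u (k * \1_(box x) u)%:E <= B%:E)%E.
  apply: le_trans QB; rewrite /Qp_integral [leRHS]integral_mkcond /area.
  apply: ge0_le_integral_nonmeas => u; first by rewrite lee_fin mulr_ge0.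
  have [ux|ux] := pselect (box x u); last first.
    rewrite indicE memNset // mulr0 patchE; case: ifP => // _.
    by rewrite lee_fin mulr_ge0 ?sqr_ge0 ?powR_ge0.
  rewrite patchT; last by rewrite inE; exact: box_disc ux.
  rewrite indicE mem_set // mulr1 lee_fin.
  apply: ler_pM; rewrite ?sqr_ge0 ?powR_ge0 //.
    apply: lerXn2r; rewrite ?nnegrE ?modulus_ge0 //; first by apply: mulr_ge0.
    exact: DH_delta0_derivative_ge.
  apply: ge0_ler_powR; rewrite ?nnegrE ?(ltW p0) //.
    by apply: gap_ge0; [rewrite in_disc modulus_real ger0_norm; lra|exact: box_disc ux].
  exact: gap_box_ge.
rewrite area_box // lee_fin /k => h.
have e0 : 0 < 8 `^ p :> R by rewrite powR_gt0.
have E8 : (1 / 8) `^ p = (8 `^ p)^-1 :> R.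
  by rewrite div1r -powR_inv1 // -powRrM mulrC powRrM powR_inv1 ?powR_ge0.
move: h; rewrite E8 -(ler_pM2l (_ : 0 < 2 * 200 ^+ 2 * 8 `^ p * (1 - x) ^+ 4)); last first.
  by rewrite !mulr_gt0 // exprn_gt0.
rewrite (_ : _ * (_ / _ * _) = m ^+ 2); last by rewrite /c; field; rewrite !gt_eqF.
by move/le_trans; apply; rewrite le_eqVlt; apply/orP; left; apply/eqP; ring.
Qed.

End LowerBound.

(** * Tail bounds and the Carleson condition *)

Section CarlesonTail.
Context {R : realType}.
Variable mu : {finite_measure set (measurableTypeR R) -> \bar R}.

Lemma Carleson_tail : mu (~` `[0%R, 1%R[) = 0%E -> Carleson mu 2 ->
  exists C, forall s : R, 0 < s -> fine (mu `[1 - s, 1%R[%classic) <= C * s ^+ 2.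
Proof.
move=> mu_supp; rewrite /Carleson; set S := ereal_sup _ => S_fin.
have ratio t : 0 <= t < 1 -> (Carleson_ratio mu 2 t <= S)%E.
  by move=> t01; apply: ereal_sup_ubound; exists t.
have S0 : (0 <= S)%E.
  apply: le_trans (ratio 0 _); last by rewrite lexx ltr01.
  by rewrite /Carleson_ratio mule_ge0 // lee_fin invr_ge0 powR_ge0.
have [C CE] : exists C : R, S = C%:E.
  by exists (fine S); rewrite fineK // ge0_fin_numE.
have C0 : 0 <= C by rewrite -lee_fin -CE.
exists C => s s0.
have fin A : measurable A -> mu A = (fine (mu A))%:E.
  by move=> mA; rewrite fineK // fin_num_measure.
have small r : 0 < r -> r <= 1 -> fine (mu `[1 - r, 1%R[%classic) <= C * r ^+ 2.
  move=> r0 r1; have := ratio (1 - r); rewrite subr_ge0 r1 gtrBl r0 => /(_ isT).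
  rewrite /Carleson_ratio CE fin // subKr -EFinM lee_fin.
  rewrite (_ : r `^ 2 = r ^+ 2); last by rewrite -powR_mulrn // ltW.
  by rewrite ler_pdivrMr // exprn_gt0.
have [s1|s1] := leP s 1; first exact: small.
(* For [s > 1] the interval leaves [[0, 1)], outside of which [mu] is null: its mass is at most that
   of [[0, 1)], hence at most [C <= C s^2]. *)
apply: (@le_trans _ _ C); last by rewrite ler_peMr // exprn_ege1 // ltW.
have /= := small 1 ltr01 (lexx _); rewrite subrr expr1n mulr1; apply: le_trans.
rewrite -lee_fin -!fin //.
apply: (@le_trans _ _ (mu (`[0%R, 1%R[ `|` ~` `[0%R, 1%R[)))%E.
  by apply: le_measure; rewrite ?inE // setUv.
apply: (le_trans (measureU2 _ _ _)) => //; first exact: measurableC.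
by rewrite [X in (_ + X)%E]mu_supp adde0.
Qed.

Lemma tail_Carleson (C : R) : 0 <= C ->
  (forall x, 1 / 2 <= x -> x < 1 -> fine (mu `[x, 1%R[%classic) <= C * (1 - x) ^+ 2) ->
  Carleson mu 2.
Proof.
(* The second summand handles [t < 1/2], where [(1 - t)^2 >= 1/4] and the total mass is enough. *)
move=> C0 tail; pose B := C + 4 * fine (mu setT).
have T0 : 0 <= fine (mu setT) by rewrite fine_ge0.
rewrite /Carleson; apply: (@le_lt_trans _ _ B%:E); last exact: ltry.
apply: ge_ereal_sup => _ [t + <-]; rewrite /= in_itv /= => /andP[t0 t1].
have d0 : 0 < 1 - t by rewrite subr_gt0.
have fin A : measurable A -> mu A = (fine (mu A))%:E.
  by move=> mA; rewrite fineK // fin_num_measure.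
rewrite /Carleson_ratio fin // -EFinM lee_fin (_ : _ `^ 2 = (1 - t) ^+ 2); last first.
  by rewrite -powR_mulrn // ltW.
rewrite ler_pdivrMr ?exprn_gt0 //; have [t2|t2] := leP (1 / 2) t.
  by rewrite (le_trans (tail _ t2 t1)) // ler_wpM2r ?sqr_ge0 // lerDl mulr_ge0.
apply: (@le_trans _ _ (fine (mu setT))).
  by rewrite -lee_fin -!fin //; apply: le_measure; rewrite ?inE.
have : 1 / 4 <= (1 - t) ^+ 2 by nra.
rewrite /B => h; nra.
Qed.

End CarlesonTail.

Lemma Hinfty_bound (R : realType) (f : R[i] -> R[i]) : Hinfty f ->
  exists M : R, forall z, unit_disc z -> modulus (f z) <= M.
Proof. by case=> _ [M fM]; exists M => z zD; rewrite -lecR -modulusE; exact: fM. Qed.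

Unset Implicit Arguments.

Theorem theorem3p9 (R : realType) (p : R)
    (mu : {finite_measure set (measurableTypeR R) -> \bar R})
    (p_gt0 : 0 < p) (p_lt2 : p < 2)
    (mu_supp : mu (~` `[0%R, 1%R[) = 0%E)
    (mu_log : (\int[mu]_(t in `[0%R, 1%R[) (ln (2 / (1 - t)))%:E < +oo)%E) :
  DH_Hinfty_sub_Qp mu p <-> Carleson mu 2.
Proof.
split=> [DHQ|/(Carleson_tail mu_supp)[C tail] f a fH fa].
  have cst1 : Hinfty (fun=> 1 : R[i]).
    split=> [z _|]; first exact: derivable_cst.
    by exists 1 => z _; rewrite normr1.
  have [_ [_]] := DHQ _ _ cst1 has_expansion_cst1.
  set S := ereal_sup _ => S_fin.
  have QS x : 1 / 2 <= x -> x < 1 ->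
      (Qp_integral p (DH mu (fun k => (k == 0%N)%:R)) x%:C%C <= S)%E.
    move=> x2 x1; apply: ereal_sup_ubound; exists x%:C%C => //.
    by rewrite in_disc modulus_real ger0_norm //; lra.
  have S0 : (0 <= S)%E.
    apply: (le_trans _ (QS (1 / 2) _ _)); [|lra|lra].
    by apply: integral_ge0 => u _; rewrite lee_fin mulr_ge0 ?sqr_ge0 ?powR_ge0.
  have SE : S = (fine S)%:E by rewrite fineK // ge0_fin_numE.
  set B := fine S in SE; have B0 : 0 <= B by rewrite -lee_fin -SE.
  (* The squared tail is at most [K (1 - x)^4], so the square root of [K] is a Carleson constant
     near 1. *)
  pose K := 2 * 200 ^+ 2 * 8 `^ p * B.
  have K0 : 0 <= K by rewrite !mulr_ge0 ?powR_ge0.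
  apply: (@tail_Carleson _ _ (Num.sqrt K)); first exact: sqrtr_ge0.
  move=> x x2 x1; have := QS x x2 x1; rewrite SE => /(tail_sqr_le p_gt0 x2 x1) h.
  rewrite -(@ler_pXn2r _ 2) ?nnegrE ?fine_ge0 //; last by rewrite mulr_ge0 ?sqrtr_ge0 ?sqr_ge0.
  by rewrite exprMn sqr_sqrtr // -exprM.
have [M fM] := Hinfty_bound fH.
have aM k : modulus (a k) <= M := cauchy_estimate k fa fM.
have cB n : modulus (DH_coef mu a n) <= M * (5 * C) * n.+1%:R by exact: DH_coef_le.
have cB3 n : modulus (DH_coef mu a n) <= M * (5 * C) * n.+1%:R ^+ 3.
  have C0 := tail_const_ge0 tail; have M0 : 0 <= M := le_trans (modulus_ge0 _) (aM 0%N).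
  rewrite (le_trans (cB n)) // ler_wpM2l ?mulr_ge0 //.
  by rewrite -[leLHS]expr1 ler_weXn2l // ler1n.
have DH_analytic : analytic_disc (DH mu a).
  by move=> z zD; rewrite DHE; exact: power_sum_derivable cB zD.
split; [split; [|  |exact: DH_analytic]|split; first exact: DH_analytic].
- by move=> n; apply: DH_inner_cvg aM; exact: moment_summable tail.
- move=> z zD; apply/cvg_ex; exists (power_sum (DH_coef mu a) z).
  exact: power_sum_cvg cB3 zD.
- set L := 32 * ((144 * M * C) ^+ 2 * 16 `^ p) / (1 - 2^-1 `^ p).
  apply: (@le_lt_trans _ _ L%:E); last exact: ltry.
  apply: ge_ereal_sup => _ [w wD <-]; apply: (Qp_integral_le p_gt0 wD) => z zD.
  exact: DH_derivative_le fa fM zD.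
Qed.
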